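(* Let $p,q$ be coprime positive integers and let $VT_{p,q}^1$ be the virtual knot obtained from the standard $(p,q)$-torus knot diagram by replacing by virtual crossings all classical crossings lying on one overstrand. Then $VT_{p,q}^1$ is virtually null-homotopic and its virtual unknotting number is \[ \mathrm{vu}(VT_{p,q}^1)=\frac{(p-1)(q-1)}{2}. \]
   Context: Virtual knots: a virtual knot diagram is a knot diagram some of whose crossings are virtual crossings, drawn with a small circle and carrying no over/under information; the other crossings are classical. Two diagrams represent the same virtual knot iff they are related by planar isotopy and generalized Reidemeister moves: the classical moves R1, R2, R3, the virtual moves VR1, VR2, VR3 (the analogues of R1–R3 with only virtual crossings), and the mixed move MR (a strand with two virtual crossings slides past a classical crossing). A crossing change exchanges over- and understrand at a classical crossing. A virtual knot is virtually null-homotopic if it can be turned into the unknot by generalized Reidemeister moves and crossing changes; for such a $K$, the virtual unknotting number $\mathrm{vu}(K)$ is the minimal number of crossing changes needed (together with any number of generalized Reidemeister moves) to turn $K$ into the unknot. Braid conventions: braids on $p$ strands are drawn horizontally, oriented left to right, with positions $1,\dots,p$ numbered from top to bottom, and words are read left to right. The generator $\sigma_m$ ($1\le m\le p-1$) is a classical crossing at which the strand in position $m$ moves to position $m+1$, passing over the strand moving from position $m+1$ to position $m$. The standard $(p,q)$-torus knot diagram is the closure of $(\sigma_1\sigma_2\cdots\sigma_{p-1})^q$. In each block $\sigma_1\cdots\sigma_{p-1}$, one strand passes over the other $p-1$ strands; call these strands the $q$ overstrands. $VT^1_{p,q}$ is the closure of the virtual braid obtained by replacing the $p-1$ crossings of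 the first block by virtual crossings. *)

(* Defs.v *)
(* Virtual knots are modelled by signed Gauss
   codes (Gauss diagrams) modulo the Gauss-diagram versions of the classical
   Reidemeister moves. *)
From Stdlib Require Import Relations.
From mathcomp Require Import all_boot.

Set Implicit Arguments.
Unset Strict Implicit.
Unset Printing Implicit Defensive.

Definition letter := (nat * bool * bool)%type.
Definition lab (t : letter) : nat := t.1.1.
Definition is_over (t : letter) : bool := t.1.2.
Definition is_pos (t : letter) : bool := t.2.

(* A (one-component) virtual knot diagram, read from a base point along the
   orientation; virtual crossings are invisible. The empty code is the
   trivial diagram (unknot). *)
Definition gcode := seq letter.
Definition labels (x : gcode) : seq nat := map lab x.

Definition wf_gcode (x : gcode) : bool :=
  all (fun c => (count (fun t => lab t == c) x == 2)
                && has (fun t => (lab t == c) && is_over t) x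
                && has (fun t => (lab t == c) && ~~ is_over t) x
                && ~~ (has (fun t => (lab t == c) && is_pos t) x
                       && has (fun t => (lab t == c) && ~~ is_pos t) x))
      (labels x).

(* Three local strands i = 0,1,2 (numbered in the order their segments
   appear in the code) modelled as oriented straight lines forming a
   triangle.  [w] chooses the counterclockwise cyclic order of the lines
   around the triangle, [e i] says whether line i is oriented along the
   counterclockwise boundary orientation, [h] gives heights (top/middle/
   bottom), [l i j] the label of the crossing of lines i and j.  The sign of
   a crossing is the sign of det(dir_over, dir_under). *)
Section R3.
Variables (w : bool) (e : nat -> bool) (h : nat -> nat) (l : nat -> nat -> nat).
Definition r3succ (i : nat) : nat := if w then (i + 1) %% 3 else (i + 2) %% 3.
Definition r3pred (i : nat) : nat := if w then (i + 2) %% 3 else (i + 1) %% 3.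
Definition r3sign (i j : nat) : bool :=
  let o := if h j < h i then i else j in
  let u := if h j < h i then j else i in
  (e o == e u) == (u == r3succ o).
Definition r3letter (i j : nat) : letter := (l i j, h j < h i, r3sign i j).
Definition r3seg (i : nat) : gcode :=
  if e i then [:: r3letter i (r3pred i); r3letter i (r3succ i)]
  else [:: r3letter i (r3succ i); r3letter i (r3pred i)].
End R3.

Definition R3config (S0 S1 S2 : gcode) : Prop :=
  exists (w : bool) (e : nat -> bool) (h : nat -> nat) (l : nat -> nat -> nat),
    [/\ uniq [:: h 0; h 1; h 2],
        uniq [:: l 0 1; l 0 2; l 1 2],
        (forall i j, l i j = l j i) &
        [/\ S0 = r3seg w e h l 0, S1 = r3seg w e h l 1 & S2 = r3seg w e h l 2]].

Inductive gmove : gcode -> gcode -> Prop :=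
| gm_rot (x : gcode) (n : nat) : gmove x (rot n x)            (* base point *)
| gm_relabel (x : gcode) (f : nat -> nat) :
    injective f -> gmove x (map (fun t => (f (lab t), is_over t, is_pos t)) x)
| gm_R1 (u v : gcode) (c : nat) (o s : bool) :
    c \notin labels (u ++ v) ->
    gmove (u ++ v) (u ++ [:: (c, o, s); (c, ~~ o, s)] ++ v)
| gm_R2 (u v x : gcode) (c d : nat) (o s : bool) (A B : gcode) :
    c != d -> c \notin labels (u ++ v ++ x) -> d \notin labels (u ++ v ++ x) ->
    perm_eq A [:: (c, o, s); (d, o, ~~ s)] ->
    perm_eq B [:: (c, ~~ o, s); (d, ~~ o, ~~ s)] ->
    gmove (u ++ v ++ x) (u ++ A ++ v ++ B ++ x)
| gm_R3 (u1 u2 u3 u4 S0 S1 S2 : gcode) :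
    R3config S0 S1 S2 ->
    all (fun c => c \notin labels (u1 ++ u2 ++ u3 ++ u4)) (labels (S0 ++ S1 ++ S2)) ->
    gmove (u1 ++ S0 ++ u2 ++ S1 ++ u3 ++ S2 ++ u4)
          (u1 ++ rev S0 ++ u2 ++ rev S1 ++ u3 ++ rev S2 ++ u4).

(* Equivalence of virtual knot diagrams (generalized Reidemeister moves and
   planar isotopy; virtual and mixed moves are invisible on Gauss codes). *)
Definition vequiv : relation gcode := clos_refl_sym_trans gcode gmove.

Definition unknot : gcode := [::].

Definition crossing_change (c : nat) (x : gcode) : gcode :=
  map (fun t => if lab t == c then (lab t, ~~ is_over t, ~~ is_pos t) else t) x.

Fixpoint unknots_with (n : nat) (x : gcode) : Prop :=
  match n with
  | 0 => vequiv x unknot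
  | n'.+1 => exists y c, [/\ vequiv x y, c \in labels y &
                            unknots_with n' (crossing_change c y)]
  end.

Definition virtually_null_homotopic (x : gcode) : Prop :=
  exists n, unknots_with n x.

Definition is_virtual_unknotting_number (x : gcode) (n : nat) : Prop :=
  unknots_with n x /\ forall m, unknots_with m x -> n <= m.

(* Strand positions 1..p, top to bottom; braids drawn left to right.
   Sig m : strand at position m goes to m+1 passing OVER the strand m+1 -> m.
   SigI m: its inverse (strand m -> m+1 passes under).
   Vir m : virtual crossing between positions m and m+1. *)
Inductive vgen := Sig of nat | SigI of nat | Vir of nat.

Definition gen_step (g : vgen) (k pos : nat) : option letter * nat :=
  match g with
  | Sig m => if pos == m then (Some (k, true, true), m.+1)
             else if pos == m.+1 then (Some (k, false, true), m) else (None, pos)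
  | SigI m => if pos == m then (Some (k, false, false), m.+1)
              else if pos == m.+1 then (Some (k, true, false), m) else (None, pos)
  | Vir m => if pos == m then (None, m.+1)
             else if pos == m.+1 then (None, m) else (None, pos)
  end.

Fixpoint braid_pass (w : seq vgen) (k pos : nat) : gcode * nat :=
  match w with
  | [::] => ([::], pos)
  | g :: w' => let (o, pos1) := gen_step g k pos in
               let (s, pos2) := braid_pass w' k.+1 pos1 in
               (match o with Some t => t :: s | None => s end, pos2)
  end.

Fixpoint closure_iter (n : nat) (w : seq vgen) (pos : nat) : gcode :=
  match n with
  | 0 => [::]
  | n'.+1 => let (s, pos') := braid_pass w 0 pos in s ++ closure_iter n' w pos'
  end.

(* Gauss code of the closure of a p-strand virtual braid whose closure is a
   knot: starting at position 1 one traverses the word p times.  The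
   classical crossing at index k of the word gets label k. *)
Definition braid_closure (p : nat) (w : seq vgen) : gcode := closure_iter p w 1.

Definition torus_block (p : nat) : seq vgen := map Sig (iota 1 p.-1).

(* VT^1_{p,q}: closure of (sigma_1 ... sigma_{p-1})^q with the crossings of
   the first block replaced by virtual crossings. *)
Definition VT1 (p q : nat) : gcode :=
  braid_closure p (map Vir (iota 1 p.-1) ++ flatten (nseq q.-1 (torus_block p))).

(* Main.v *)
Require Import Defs.
From Stdlib Require Import Relations.
From mathcomp Require Import all_boot all_order all_algebra.
From mathcomp Require Import zify ring.
Import GRing.Theory Num.Theory.

Set Implicit Arguments.
Unset Strict Implicit.
Unset Printing Implicit Defensive.

(** Lower bound.  Walk along a diagram with a height that goes up by one at
    each positive overpass or negative underpass and down by one at the other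
    passages.  The difference of the heights at the two passages of a crossing
    is its index up to sign; the sum of the signs of the crossings of nonzero
    index is invariant under Reidemeister moves, vanishes on the unknot and
    changes by at most 2 at a crossing change.  In VT^1_{p,q} the height is, up
    to a constant depending only on the pass around the annulus, the strand
    position, and the constants of the p passes are distinct.  Hence all
    (p-1)(q-1) crossings, which are positive, have nonzero index.

    Upper bound.  Change the crossings whose first passage is under.  The
    virtual overstrand makes the closure a single arc in the annulus from one
    boundary circle to the other; once descending it can be pulled tight to a
    crossingless spiral.  Combinatorially: the code of the closure of a word in
    adjacent transpositions is unchanged under the Coxeter relations (R2, R3)
    and under the conjugation m w -> w (m+1).  Sorting the strands by pass
    number, before and after the word, rewrites the word by Coxeter relations
    as A rev(A+1), which conjugation and R2 collapse.  Comparing the invariant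
    of VT^1_{p,q} with that of this unknotted diagram shows that exactly half of
    the crossings were changed. *)

(** * Heights and the index writhe *)

Definition upward (t : letter) : bool := is_over t == is_pos t.
Definition eps (t : letter) : int := if upward t then 1%R else (-1)%R.
Definition total (x : gcode) : int := (\sum_(t <- x) eps t)%R.

(* The height recorded at a letter is the larger of those before and after it:
   crossing changes preserve it, and at a crossing the two recorded heights
   differ by the index. *)
Fixpoint heights (a : int) (x : gcode) : seq (letter * int) :=
  if x is t :: x' then (t, (a + (upward t)%:Z)%R) :: heights (a + eps t)%R x' else [::].

Definition sign_int (b : bool) : int := if b then 1%R else (-1)%R.

Definition pair_weight (u v : letter * int) : int :=
  if [&& lab u.1 == lab v.1, is_over u.1, ~~ is_over v.1 & u.2 != v.2]
  then sign_int (is_pos u.1) else 0%R.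

Definition pair_sum (L : seq (letter * int)) : int :=
  (\sum_(u <- L) \sum_(v <- L) pair_weight u v)%R.

Definition index_writhe (x : gcode) : int := pair_sum (heights 0 x).

Lemma total_cat x y : total (x ++ y) = (total x + total y)%R.
Proof. by rewrite /total big_cat. Qed.

Lemma total_perm x y : perm_eq x y -> total x = total y.
Proof. exact: perm_big. Qed.

Lemma heights_cat a x y : heights a (x ++ y) = heights a x ++ heights (a + total x)%R y.
Proof.
elim: x a => [|t x IH] a /=; first by rewrite /total big_nil addr0.
by rewrite IH /total big_cons addrA.
Qed.

Lemma map_fst_heights a x : map fst (heights a x) = x.
Proof. by elim: x a => //= t x IH a; rewrite IH. Qed.

Definition shift_heights (g : nat -> int) (u : letter * int) : letter * int :=
  (u.1, (u.2 + g (lab u.1))%R).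

Lemma heights_shift a b x : heights (a + b)%R x = map (shift_heights (fun=> b)) (heights a x).
Proof.
elim: x a => //= t x IH a; rewrite -IH /shift_heights /=.
by congr (_ :: _); [congr pair; ring | congr heights; ring].
Qed.

Lemma pair_sum_perm L L' : perm_eq L L' -> pair_sum L = pair_sum L'.
Proof.
move=> h; rewrite /pair_sum (perm_big _ h) /=.
by apply: eq_bigr => u _; rewrite (perm_big _ h).
Qed.

Lemma pair_sum_map (f : letter * int -> letter * int) L :
  (forall u v, pair_weight (f u) (f v) = pair_weight u v) -> pair_sum (map f L) = pair_sum L.
Proof.
move=> h; rewrite /pair_sum big_map; apply: eq_bigr => u _.
by rewrite big_map; apply: eq_bigr => v _.
Qed.

(** Only the height difference at a crossing enters the weights, so the shift may depend on the
    crossing. A constant shift serves base point changes, a label-dependent one serves R3. *)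
Lemma pair_sum_shift g L : pair_sum (map (shift_heights g) L) = pair_sum L.
Proof.
apply: pair_sum_map => u v; rewrite /pair_weight /shift_heights /=.
case: eqP => //= ->; congr (if [&& _, _ & ~~ _] then _ else _).
by apply/eqP/eqP => [/addIr|->].
Qed.

Definition height_labels (L : seq (letter * int)) : seq nat := labels (map fst L).

Lemma height_labels_heights a x : height_labels (heights a x) = labels x.
Proof. by rewrite /height_labels map_fst_heights. Qed.

Lemma height_labels_cat L1 L2 : height_labels (L1 ++ L2) = height_labels L1 ++ height_labels L2.
Proof. by rewrite /height_labels /labels !map_cat. Qed.

Lemma pair_weight_disjoint L1 L2 : {in height_labels L1, forall c, c \notin height_labels L2} ->
  (\sum_(u <- L1) \sum_(v <- L2) pair_weight u v = 0)%R /\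
  (\sum_(u <- L2) \sum_(v <- L1) pair_weight u v = 0)%R.
Proof.
move=> h.
have key u v : u \in L1 -> v \in L2 -> lab u.1 == lab v.1 = false.
  move=> hu hv; apply/negP => /eqP e.
  have /h : lab u.1 \in height_labels L1 by rewrite /height_labels /labels -map_comp; apply: (map_f (lab \o fst)).
  by rewrite e /height_labels /labels -map_comp (map_f (lab \o fst)).
split; rewrite big_seq big1 // => u hu; rewrite big_seq big1 // => v hv; rewrite /pair_weight.
  by rewrite key.
by rewrite eq_sym key.
Qed.

Lemma pair_sum_cat L1 L2 : {in height_labels L1, forall c, c \notin height_labels L2} ->
  pair_sum (L1 ++ L2) = (pair_sum L1 + pair_sum L2)%R.
Proof.
move=> /pair_weight_disjoint [h1 h2]; rewrite /pair_sum big_cat /=.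
under eq_bigr do rewrite big_cat /=.
rewrite big_split /= h1 addr0; congr (_ + _)%R.
under eq_bigr do rewrite big_cat /=.
by rewrite big_split /= h2 add0r.
Qed.

(** * Paired codes and invariance under the Reidemeister moves *)

Definition paired (x : gcode) : Prop := forall c,
  perm_eq (filter (fun t => lab t == c) x) [::] \/
  exists s, perm_eq (filter (fun t => lab t == c) x) [:: (c, true, s); (c, false, s)].

Lemma paired_perm x y : perm_eq x y -> paired x -> paired y.
Proof.
move=> h hx c; have hf := perm_filter (fun t => lab t == c) h.
case: (hx c) => [h1|[s h1]]; [left | right; exists s];
  by rewrite perm_sym in hf; apply: perm_trans h1.
Qed.

Lemma filter_lab0 c x : c \notin labels x -> filter (fun t => lab t == c) x = [::].
Proof.
move=> h; apply/eqP; rewrite -size_eq0 size_filter -leqn0 leqNgt -has_count.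
by apply: contra h => /hasP [t ht /eqP <-]; apply: map_f.
Qed.

Lemma paired_cat x y : {in labels x, forall c, c \notin labels y} ->
  paired (x ++ y) <-> paired x /\ paired y.
Proof.
move=> h; split.
  move=> hxy; split=> c; move: (hxy c); rewrite filter_cat.
    case: (boolP (c \in labels x)) => [/h /filter_lab0 ->|/filter_lab0 ->].
      by rewrite cats0.
    by left.
  case: (boolP (c \in labels y)) => [hy|/filter_lab0 ->]; last by left.
  rewrite (filter_lab0 (c:=c) (x:=x)) //.
  by apply/negP => /h; rewrite hy.
case=> hx hy c; rewrite filter_cat.
case: (boolP (c \in labels x)) => [/h /filter_lab0 ->|/filter_lab0 ->].
  by rewrite cats0.
exact: hy.
Qed.

Lemma paired2 c o s : paired [:: (c, o, s); (c, ~~ o, s)].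
Proof.
move=> d /=; rewrite /lab /=; case: eqP => [<-|_]; last by left.
right; exists s; case: o => //=.
by rewrite -(perm_rev [:: _; _]) /rev.
Qed.

(** Index writhes are compared only at total height change 0, when the height is well defined on the
    whole circle. Moves act on arbitrary codes, so [paired] has to travel along a chain of moves in
    both directions. *)
Definition inv_rel (x y : gcode) : Prop :=
  [/\ total x = total y, total x = 0%R -> index_writhe x = index_writhe y & paired x <-> paired y].

(** When the total vanishes, moving the base point shifts all heights by one constant. *)
Lemma inv_rot x n : inv_rel x (rot n x).
Proof.
have hp : perm_eq x (rot n x) by rewrite perm_sym perm_rot.
split; first exact: total_perm.
  rewrite -{1 2}(cat_take_drop n x) /rot total_cat => h.
  rewrite /index_writhe !heights_cat !add0r -(pair_sum_shift (fun=> total (drop n x))) map_cat -!heights_shift add0r.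
  rewrite h; apply: pair_sum_perm; exact: permEl (perm_catC _ _).
by split; apply: paired_perm; rewrite // perm_sym.
Qed.

Lemma inv_relabel x (f : nat -> nat) : injective f ->
  inv_rel x (map (fun t => (f (lab t), is_over t, is_pos t)) x).
Proof.
move=> fI; set g := fun t : letter => _.
have hd t : eps (g t) = eps t by [].
split; first by rewrite /total big_map.
  move=> _; rewrite /index_writhe.
  have -> a : heights a (map g x) = map (fun u => (g u.1, u.2)) (heights a x).
    by elim: x a => //= t x IH a; rewrite hd IH.
  rewrite pair_sum_map // => u v; rewrite /pair_weight /g /lab /=.
  by rewrite (inj_eq fI).
have hg c : filter (fun t => lab t == f c) (map g x) = map g (filter (fun t => lab t == c) x).
  by rewrite filter_map; congr map; apply: eq_filter => t /=; rewrite /lab /= (inj_eq fI).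
have gI : injective g by move=> [[a b] c] [[a' b'] c']; rewrite /g /lab /is_over /is_pos /= => -[/fI -> -> ->].
split=> hx c.
  case: (boolP (c \in labels (map g x))) => [|/filter_lab0 ->]; last by left.
  rewrite /labels -map_comp => /mapP [t _ ->] /=; rewrite /lab /= hg.
  case: (hx (lab t)) => [h|[s h]]; [left | right; exists s].
    by move/perm_size/size0nil: h => ->.
  by have := perm_map g h.
have := hx (f c); rewrite hg.
case=> [h|[s h]]; [left|right; exists s].
  by apply: (perm_map_inj gI).
exact: (perm_map_inj gI).
Qed.

(** The kink has height change 0, so all other heights stay, and its own two letters record the same
    height: the new crossing has index 0. *)
Lemma inv_R1 (u v : gcode) (c : nat) (o s : bool) :
  c \notin labels (u ++ v) ->
  inv_rel (u ++ v) (u ++ [:: (c, o, s); (c, ~~ o, s)] ++ v).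
Proof.
move=> hc; set z := [:: _; _].
have hdis : {in labels z, forall d, d \notin labels (u ++ v)}.
  by move=> d; rewrite !inE /= /lab /= => /orP[] /eqP ->.
have tz : total z = 0%R by rewrite /total /z !big_cons big_nil /eps /upward /=; case: (o); case: (s).
split.
- by rewrite !total_cat tz add0r.
- move=> _; rewrite /index_writhe !heights_cat !add0r tz addr0.
  rewrite [RHS](pair_sum_perm (permEl (perm_catCA _ _ _))) [in RHS]pair_sum_cat; last first.
    by move=> d; rewrite height_labels_cat !height_labels_heights /labels -map_cat; apply: hdis.
  rewrite -[LHS]add0r; congr (_ + _)%R.
  rewrite /z /pair_sum /= !big_cons !big_nil /pair_weight /eps /upward /= /lab /is_over /is_pos /= !eqxx.
  by case: (o); case: (s) => /=; case: eqP => /=; lia.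
have hp : perm_eq (z ++ (u ++ v)) (u ++ z ++ v) by apply: permEl (perm_catCA _ _ _).
have hpz : paired z by apply: paired2.
have [h1 h2] := paired_cat hdis.
split => h; first by apply: (paired_perm hp); apply: h2.
by rewrite perm_sym in hp; have /h1 [] := paired_perm hp h.
Qed.


Lemma perm_eq2 (T : eqType) (s : seq T) a b :
  perm_eq s [:: a; b] -> s = [:: a; b] \/ s = [:: b; a].
Proof.
move=> h; have := perm_size h; case: s h => [|x [|y [|]]] //= h _.
have : x \in [:: a; b] by rewrite -(perm_mem h) mem_head.
rewrite !inE => /orP[] /eqP e; subst x.
  by move: h; rewrite perm_cons => /perm_small_eq -> //; left.
move: h; rewrite perm_sym -(perm_rev [:: a; b]) /rev /= perm_sym perm_cons => /perm_small_eq -> //.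
by right.
Qed.

(** Both inserted pieces have height change 0. The two letters of [A] record a common height, and so
    do those of [B]; hence the two new crossings have the same index and, their signs being
    opposite, cancel. *)
Lemma inv_R2 (u v x : gcode) (c d : nat) (o s : bool) (A B : gcode) :
  c != d -> c \notin labels (u ++ v ++ x) -> d \notin labels (u ++ v ++ x) ->
  perm_eq A [:: (c, o, s); (d, o, ~~ s)] ->
  perm_eq B [:: (c, ~~ o, s); (d, ~~ o, ~~ s)] ->
  inv_rel (u ++ v ++ x) (u ++ A ++ v ++ B ++ x).
Proof.
move=> cd hc hd pA pB.
have tA : total A = 0%R.
  by rewrite (total_perm pA) /total !big_cons big_nil /eps /upward /=; case: (o); case: (s).
have tB : total B = 0%R.
  by rewrite (total_perm pB) /total !big_cons big_nil /eps /upward /=; case: (o); case: (s).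
have pAB : perm_eq (A ++ B) ([:: (c, o, s); (c, ~~ o, s)] ++ [:: (d, o, ~~ s); (d, ~~ o, ~~ s)]).
  apply: perm_trans (perm_cat pA pB) _.
  by rewrite /= perm_cons (perm_catCA [:: _] [:: _] [:: _]) perm_refl.
have hdis : {in labels (A ++ B), forall e, e \notin labels (u ++ v ++ x)}.
  move=> e; rewrite (perm_mem (perm_map lab pAB)) !inE /= /lab /=.
  by case/or4P => /eqP ->.
have pall (T : eqType) (a b m e f : seq T) :
    perm_eq (a ++ b ++ m ++ e ++ f) ((b ++ e) ++ (a ++ m ++ f)).
  rewrite -catA perm_catCA perm_cat2l !(catA a m).
  exact: permEl (perm_catCA _ _ _).
split.
- by rewrite !total_cat tA tB !add0r.
- move=> _; rewrite /index_writhe !heights_cat !add0r tA tB !addr0.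
  rewrite [RHS](pair_sum_perm (pall _ _ _ _ _ _)) [in RHS]pair_sum_cat; last first.
    move=> e; rewrite !height_labels_cat !height_labels_heights /labels -!map_cat; exact: hdis.
  rewrite -[LHS]add0r; congr (_ + _)%R.
  move: (total u) (total u + total v)%R => a b; have dc : d == c = false by rewrite eq_sym (negbTE cd).
  case: (perm_eq2 pA) => ->; case: (perm_eq2 pB) => ->;
  rewrite /pair_sum /= !big_cons !big_nil /pair_weight /eps /upward /= /lab /is_over /is_pos /= !eqxx
     (negbTE cd) dc /=;
  case: (o); case: (s); rewrite /=; do 2 (case: eqP => /=); lia.
have hp : perm_eq ((A ++ B) ++ (u ++ v ++ x)) (u ++ A ++ v ++ B ++ x).
  by rewrite perm_sym; apply: pall.
have hpz : paired (A ++ B).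
  apply: (@paired_perm _ _ _ (_ : paired (_ ++ _))); first by rewrite perm_sym; exact: pAB.
  apply/paired_cat; last by split; apply: paired2.
  by move=> e; rewrite !inE /= /lab /= => /orP[] /eqP ->; rewrite (negbTE cd).
have [h1 h2] := paired_cat hdis.
split => h; first by apply: (paired_perm hp); apply: h2.
by rewrite perm_sym in hp; have /h1 [] := paired_perm hp h.
Qed.

(* In an R3 move the heights of both letters of the crossing of two lines
   change by the same amount, determined by the direction of the third line. *)
Lemma R3_heights w (e h : nat -> _) l (i j k : nat) a :
  [\/ (i, j, k) = (0, 1, 2), (i, j, k) = (1, 0, 2) | (i, j, k) = (2, 0, 1)] ->
  (forall i j, l i j = l j i) -> l i j != l i k ->
  h i != h j -> h i != h k ->
  forall g : nat -> int, g (l i j) = sign_int (e k) -> g (l i k) = sign_int (e j) ->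
  heights a (rev (r3seg w e h l i)) = rev (map (shift_heights g) (heights a (r3seg w e h l i))).
Proof.
move=> hijk lC hl hj hk g gj gk.
(* The height step is independent of [h]: it depends only on the directions of the two lines and on
   their cyclic order. *)
have D n m : n < 3 -> m < 3 -> n != m -> h n != h m ->
    upward (r3letter w e h l n m) = ((e n == e m) == (m == r3succ w n)).
  move=> hn hm nm hnm; rewrite /upward /r3letter /r3sign /is_over /is_pos /=.
  have hs : (n == r3succ w m) = ~~ (m == r3succ w n).
    by move: n m hn hm nm {hnm} => [|[|[|//]]] [|[|[|//]]] //; case: (w).
  have [lt|lt|e0] := ltngtP (h m) (h n); last by rewrite e0 eqxx in hnm.
    by case: (e n == _); case: (m == _).
  rewrite hs eq_sym [e m == _]eq_sym.
  by case: (e n == _); case: (m == _).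
have L n m : lab (r3letter w e h l n m) = l n m by [].
have E t : eps t = sign_int (upward t) by [].
rewrite /r3seg.
case: hijk => -[? ? ?]; subst i j k; case: w D L; case ei: (e _) => D L;
 rewrite /= /rev /= /shift_heights /= !L !E !D //= ?gj ?gk ?ei;
 move: (l 0 1) (l 0 2) (l 1 2) => *;
 rewrite /r3succ ?gj ?gk;
 case: (e 0); case: (e 1); case: (e 2); rewrite /=; congr [:: (_, _); (_, _)]; ring.
Qed.

Lemma inv_R3 (u1 u2 u3 u4 S0 S1 S2 : gcode) :
  R3config S0 S1 S2 ->
  all (fun c => c \notin labels (u1 ++ u2 ++ u3 ++ u4)) (labels (S0 ++ S1 ++ S2)) ->
  inv_rel (u1 ++ S0 ++ u2 ++ S1 ++ u3 ++ S2 ++ u4)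
          (u1 ++ rev S0 ++ u2 ++ rev S1 ++ u3 ++ rev S2 ++ u4).
Proof.
move=> [w [e [h [l [hu lu lC [e0 e1 e2]]]]]] /allP hdis.
have hp : perm_eq (u1 ++ S0 ++ u2 ++ S1 ++ u3 ++ S2 ++ u4)
          (u1 ++ rev S0 ++ u2 ++ rev S1 ++ u3 ++ rev S2 ++ u4).
  by apply/permP => P; rewrite !count_cat !count_rev.
have tr s : total (rev s) = total s by apply: total_perm; rewrite perm_rev.
have pall (T : eqType) (a1 b1 a2 b2 a3 b3 a4 : seq T) :
    perm_eq (a1 ++ b1 ++ a2 ++ b2 ++ a3 ++ b3 ++ a4) ((b1 ++ b2 ++ b3) ++ (a1 ++ a2 ++ a3 ++ a4)).
  apply/permP => P; rewrite !count_cat; lia.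
split; first exact: total_perm.
  move=> _; rewrite /index_writhe !heights_cat !tr.
  rewrite [LHS](pair_sum_perm (pall _ _ _ _ _ _ _ _)) [RHS](pair_sum_perm (pall _ _ _ _ _ _ _ _)).
  rewrite [LHS]pair_sum_cat; last first.
    by move=> c; rewrite !height_labels_cat !height_labels_heights /labels -!map_cat; apply: hdis.
  rewrite [RHS]pair_sum_cat; last first.
    move=> c; rewrite !height_labels_cat !height_labels_heights /labels -!map_cat => hc; apply: hdis.
    by move: hc; rewrite /labels !(mem_cat, map_cat) !map_rev !mem_rev.
  congr (_ + _)%R.
  move: (_ + total u1)%R => a0; move: (_ + total u2)%R => a1; move: (_ + total u3)%R => a2.
  move: hu lu; rewrite /= !inE !negb_or !andbT => /andP[/andP[h01 h02] h12] /andP[/andP[l01 l02] l12].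
  (* The crossing of two lines is shifted according to the third line, so one function of the label
     describes the change on all three segments. *)
  pose g c := if c == l 0 1 then sign_int (e 2) else if c == l 0 2 then sign_int (e 1) else sign_int (e 0).
  have g01 : g (l 0 1) = sign_int (e 2) by rewrite /g eqxx.
  have g02 : g (l 0 2) = sign_int (e 1) by rewrite /g eq_sym (negbTE l01) eqxx.
  have g12 : g (l 1 2) = sign_int (e 0) by rewrite /g eq_sym (negbTE l02) eq_sym (negbTE l12).
  rewrite e0 e1 e2.
  rewrite (@R3_heights w e h l 0 1 2 a0 _ lC l01 h01 h02 g) //; last by constructor.
  rewrite (@R3_heights w e h l 1 0 2 a1 _ lC _ _ h12 g) //; first last.
  - by rewrite lC.
  - by rewrite eq_sym.
  - by rewrite lC.
  - by constructor.
  rewrite (@R3_heights w e h l 2 0 1 a2 _ lC _ _ _ g) //; first last.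
  - by rewrite lC.
  - by rewrite lC.
  - by rewrite eq_sym.
  - by rewrite eq_sym.
  - by rewrite lC (lC 2).
  - by constructor.
  rewrite -[LHS](pair_sum_shift g) !map_cat; apply: pair_sum_perm.
  by apply/permP => P; rewrite !count_cat !count_rev.
by split; apply: paired_perm; rewrite // perm_sym.
Qed.

Lemma inv_vequiv x y : vequiv x y -> inv_rel x y.
Proof.
move=> h; elim: h => {x y} [x y h|x|x y _ [h1 h2 h3]|x y z _ [h1 h2 h3] _ [h4 h5 h6]]; first case: h.
- exact: inv_rot.
- exact: inv_relabel.
- exact: inv_R1.
- exact: inv_R2.
- exact: inv_R3.
- by [].
- by split=> [|h|]; [rewrite h1 | rewrite h2 // h1 | split=> /h3].
- split=> [|h|]; [by rewrite h1 | by rewrite h2 // h5 // -h1 | by rewrite h3].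
Qed.

(** * Effect of a crossing change on the index writhe *)

Definition change_letter (c : nat) (t : letter) : letter :=
  if lab t == c then (lab t, ~~ is_over t, ~~ is_pos t) else t.

Lemma lab_change c t : lab (change_letter c t) = lab t.
Proof. by rewrite /change_letter; case: ifP. Qed.

Lemma eps_change c t : eps (change_letter c t) = eps t.
Proof.
rewrite /change_letter; case: (lab t == c) => //.
by case: t => [[n []] []].
Qed.

Lemma total_change c x : total (crossing_change c x) = total x.
Proof. by rewrite /total big_map; apply: eq_bigr => t _; apply: eps_change. Qed.

Lemma labels_change c x : labels (crossing_change c x) = labels x.
Proof. by rewrite /labels -map_comp; apply: eq_map => t; apply: lab_change. Qed.

Lemma heights_change c a x :
  heights a (crossing_change c x) = map (fun u => (change_letter c u.1, u.2)) (heights a x).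
Proof.
elim: x a => //= t x IH a; rewrite -/(change_letter c t) eps_change IH; congr ((_, _) :: _).
have := eps_change c t; rewrite /eps; by case: (upward _); case: (upward t).
Qed.

Lemma paired_change c x : paired x -> paired (crossing_change c x).
Proof.
move=> hx d; rewrite filter_map (eq_filter (a2 := fun t => lab t == d)); last first.
  by move=> t /=; rewrite -/(change_letter c t) lab_change.
case: (hx d) => [h|[s h]]; have := perm_map (change_letter c) h; first by left.
rewrite /= /change_letter /lab /is_over /is_pos /=.
case: eqP => _ h'; right; [exists (~~ s)|by exists s].
by apply: perm_trans h' _; rewrite -(perm_rev [:: _; _]).
Qed.

(** Heights, hence indices, are unaffected, so only the contribution of [c] can change: it stays 0
    or passes between 1 and -1. *)
Lemma index_writhe_change c x : paired x ->
  (`|index_writhe (crossing_change c x) - index_writhe x| <= 2)%R.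
Proof.
move=> hx; rewrite /index_writhe heights_change.
set f := fun u : letter * int => _; move: (0%R) => a.
pose P (u : letter * int) := lab u.1 == c.
have hp : perm_eq (heights a x) (filter P (heights a x) ++ filter (predC P) (heights a x)).
  by rewrite perm_sym; apply: permEl (perm_filterC _ _).
have hd : {in height_labels (filter P (heights a x)), forall d, d \notin height_labels (filter (predC P) (heights a x))}.
  move=> d; rewrite /height_labels /labels -!map_comp => /mapP [u]; rewrite mem_filter => /andP[/eqP hu _] ->.
  apply/mapP => -[v]; rewrite mem_filter => /andP[/= hv _] /= e; move: hv.
  by rewrite /P -e hu eqxx.
have hL (M : seq (letter * int)) : height_labels (map f M) = height_labels M.
  by rewrite /height_labels /labels -!map_comp; apply: eq_map => u /=; rewrite lab_change.
rewrite (pair_sum_perm (perm_map f hp)) (pair_sum_perm hp) map_cat !pair_sum_cat ?hL //.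
have -> : map f (filter (predC P) (heights a x)) = filter (predC P) (heights a x).
  rewrite -[RHS]map_id; apply/eq_in_map => -[t v]; rewrite mem_filter /P /f /change_letter /=.
  by case/andP => /negbTE ->.
have hm : map fst (filter P (heights a x)) = filter (fun t => lab t == c) x.
  by rewrite -[in RHS](map_fst_heights a x) filter_map.
move: (pair_sum (filter (predC P) _)) => w.
case: (hx c) => [|[s]]; rewrite -hm; [move=> /perm_size | move/perm_eq2].
  rewrite size_map => /size0nil ->.
  by rewrite /pair_sum !big_nil; lia.
move: (filter P _) => M; move=> hM.
have {hM} : exists v v', M = [:: ((c, true, s), v); ((c, false, s), v')] \/
                        M = [:: ((c, false, s), v); ((c, true, s), v')].
  case: M hM => [|[t v] [|[t' v'] [|? ?]]] /= [] // [-> ->]; exists v, v'; by [left|right].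
case=> v [v' [|] ->]; rewrite /pair_sum /= !big_cons !big_nil /pair_weight /f /change_letter /lab /is_over /is_pos /= !eqxx /=;
 case: (s) => /=; do 2 (case: eqP => /=); lia.
Qed.

Lemma unknots_with_index_writhe m x : unknots_with m x -> paired x -> total x = 0%R ->
  (`|index_writhe x| <= 2 * m%:Z)%R.
Proof.
elim: m x => [|m IH] x /=.
  move=> /inv_vequiv [_ h _] _ /h ->; rewrite /index_writhe /pair_sum /= big_nil; lia.
move=> [y [c [/inv_vequiv [h1 h2 h3] _ /IH h]]] hp ht.
have py : paired y by apply/h3.
have := h (paired_change c py); rewrite total_change -h1 => /(_ ht).
by have := index_writhe_change c py; rewrite h2 //; lia.
Qed.

(** * Words of adjacent transpositions *)

(* Strand positions and braid letters are numbered from 0 here. *)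
Definition swap (m x : nat) : nat :=
  if x == m then m.+1 else if x == m.+1 then m else x.

Definition act (w : seq nat) (x : nat) : nat := foldl (fun y m => swap m y) x w.

(** The Coxeter presentation of the symmetric group on p positions, each relation being a single
    rewriting in a context. The bounds keep both sides in range together. *)
Inductive coxeter (p : nat) : seq nat -> seq nat -> Prop :=
| coxeter_refl w : coxeter p w w
| coxeter_sym w w' : coxeter p w w' -> coxeter p w' w
| coxeter_trans w2 w1 w3 : coxeter p w1 w2 -> coxeter p w2 w3 -> coxeter p w1 w3
| coxeter_far u v m n : m.+1 < n -> n.+1 < p ->
    coxeter p (u ++ [:: m; n] ++ v) (u ++ [:: n; m] ++ v)
| coxeter_braid u v m : m.+2 < p ->
    coxeter p (u ++ [:: m; m.+1; m] ++ v) (u ++ [:: m.+1; m; m.+1] ++ v)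
| coxeter_inv u v m : m.+1 < p -> coxeter p (u ++ [:: m; m] ++ v) (u ++ v).

Definition in_range (p : nat) (w : seq nat) : bool := all (fun m => m.+1 < p) w.

Lemma coxeter_ctx p u v w w' : coxeter p w w' -> coxeter p (u ++ w ++ v) (u ++ w' ++ v).
Proof.
elim=> {w w'} [w|w w' _ IH|w2 w1 w3 _ IH1 _ IH2|u' v' m n h1 h2|u' v' m h|u' v' m h].
- exact: coxeter_refl.
- exact: coxeter_sym.
- exact: coxeter_trans IH2.
- by have := coxeter_far (u ++ u') (v' ++ v) h1 h2; rewrite -!catA.
- by have := coxeter_braid (u ++ u') (v' ++ v) h; rewrite -!catA.
- by have := coxeter_inv (u ++ u') (v' ++ v) h; rewrite -!catA.
Qed.

Lemma coxeter_cat p w1 w2 w1' w2' :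
  coxeter p w1 w1' -> coxeter p w2 w2' -> coxeter p (w1 ++ w2) (w1' ++ w2').
Proof.
move=> h1 h2; apply: coxeter_trans (_ : coxeter p (w1' ++ w2) _).
  exact: (coxeter_ctx [::] w2 h1).
by have := coxeter_ctx w1' [::] h2; rewrite !cats0.
Qed.

Lemma coxeter_map p w w' : coxeter p w w' -> coxeter p.+1 (map S w) (map S w').
Proof.
elim=> {w w'} [w|w w' _ IH|w2 w1 w3 _ IH1 _ IH2|u' v' m n h1 h2|u' v' m h|u' v' m h];
  rewrite ?map_cat /=.
- exact: coxeter_refl.
- exact: coxeter_sym.
- exact: coxeter_trans IH2.
- exact: coxeter_far.
- exact: coxeter_braid.
- exact: coxeter_inv.
Qed.

Lemma coxeter_inv1 p m : m.+1 < p -> coxeter p [:: m; m] [::].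
Proof. exact: (@coxeter_inv p [::] [::]). Qed.

Lemma coxeter_far1 p m n : m.+1 < p -> n.+1 < p -> (m.+1 < n) || (n.+1 < m) ->
  coxeter p [:: m; n] [:: n; m].
Proof.
move=> hm hn /orP[] h; last apply: coxeter_sym; exact: (@coxeter_far p [::] [::]).
Qed.

Lemma coxeter_comm p n w : n.+1 < p -> in_range p w ->
  all (fun m => (m.+1 < n) || (n.+1 < m)) w -> coxeter p (n :: w) (rcons w n).
Proof.
move=> hn; elim: w => [|m w IH] /=; first by move=> *; apply: coxeter_refl.
move=> /andP[hm hw] /andP[hmn hall].
apply: coxeter_trans (coxeter_cat (w1 := [:: n; m]) (w1' := [:: m; n]) (w2 := w) _ (coxeter_refl _ _)) _.
  by apply: coxeter_far1 => //; rewrite orbC.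
exact: (coxeter_cat (coxeter_refl p [:: m]) (IH hw hall)).
Qed.

Lemma coxeter_rev p w : in_range p w -> coxeter p (w ++ rev w) [::].
Proof.
elim: w => [|m w IH] /=; first by move=> *; apply: coxeter_refl.
case/andP=> hm /IH h; rewrite rev_cons -rcons_cat -cats1.
apply: coxeter_trans (coxeter_ctx [:: m] [:: m] h) _.
exact: coxeter_inv1.
Qed.

(** The letter m commutes left past the part of the run above m.+1, enters a braid relation with m,
    m.+1, and leaves m.+1 in front, which commutes past the part below m. *)
Lemma coxeter_run1 p k m : m <= k -> k.+2 < p ->
  coxeter p (iota 0 k.+2 ++ [:: m]) (m.+1 :: iota 0 k.+2).
Proof.
move=> mk kp.
have e : iota 0 k.+2 = iota 0 m ++ [:: m; m.+1] ++ iota m.+2 (k - m).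
  have -> : k.+2 = m + (2 + (k - m)) by lia.
  by rewrite !iotaD add0n /= addn2.
have okI a n : a + n < p -> in_range p (iota a n).
  by move=> h; apply/allP => x; rewrite mem_iota; lia.
rewrite e.
apply: coxeter_trans (_ : coxeter p (iota 0 m ++ [:: m; m.+1] ++ (m :: iota m.+2 (k - m))) _).
  rewrite -!catA; apply: coxeter_cat (coxeter_refl _ _) _; apply: coxeter_cat (coxeter_refl _ _) _.
  rewrite cats1; apply: coxeter_sym; apply: coxeter_comm; [lia|apply: okI; lia|].
  by apply/allP => x; rewrite mem_iota; lia.
apply: coxeter_trans (_ : coxeter p (iota 0 m ++ [:: m.+1; m; m.+1] ++ iota m.+2 (k - m)) _).
  by apply: (@coxeter_braid p (iota 0 m)); lia.
have h : coxeter p (iota 0 m ++ [:: m.+1]) (m.+1 :: iota 0 m).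
  rewrite cats1; apply: coxeter_sym; apply: coxeter_comm; [lia|apply: okI; lia|].
  by apply/allP => x; rewrite mem_iota; lia.
by have := coxeter_ctx [::] ([:: m; m.+1] ++ iota m.+2 (k - m)) h; rewrite /= -!catA.
Qed.

(** Each letter of the second run crosses the first one and comes out raised by one. In sorting
    words this exchanges two successive insertions. *)
Lemma coxeter_run p k j : j <= k -> k.+1 < p ->
  coxeter p (iota 0 k.+1 ++ iota 0 j) (iota 1 j ++ iota 0 k.+1).
Proof.
move=> jk kp; elim: j jk => [|j IH] jk.
  by rewrite cats0; apply: coxeter_refl.
rewrite -[j.+1]addn1 !iotaD /= catA add0n.
apply: coxeter_trans (coxeter_cat (IH (ltnW jk)) (coxeter_refl _ _)) _.
rewrite -!catA; apply: coxeter_cat (coxeter_refl _ _) _.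
case: k jk kp {IH} => // k jk kp; exact: coxeter_run1.
Qed.

(* Insertion sort of the values f 0, ..., f (n-1) into decreasing order, as a
   word of adjacent transpositions. *)
Fixpoint sorting_word (n : nat) (f : nat -> nat) : seq nat :=
  if n is n'.+1 then
    map S (sorting_word n' (fun k => f k.+1)) ++ iota 0 (count (fun k => f 0 < f k.+1) (iota 0 n'))
  else [::].

Lemma sorting_word_mono n f g :
  {in gtn n &, forall i j, (f i < f j) = (g i < g j)} -> sorting_word n f = sorting_word n g.
Proof.
elim: n f g => //= n IH f g h; congr (map S _ ++ iota 0 _).
  by apply: IH => i j hi hj; apply: h.
by apply: eq_in_count => k; rewrite mem_iota => /andP[_ hk]; apply: h.
Qed.

Lemma eq_sorting_word n f g : {in gtn n, f =1 g} -> sorting_word n f = sorting_word n g.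
Proof. by move=> h; apply: sorting_word_mono => i j hi hj; rewrite !h. Qed.

Lemma in_range_sorting_word n f : in_range n (sorting_word n f).
Proof.
elim: n f => //= n IH f; rewrite /in_range all_cat all_map.
apply/andP; split; first by apply: sub_all (IH (fun k => f k.+1)).
apply/allP => x; rewrite mem_iota => /andP[_].
have := count_size (fun k => f 0 < f k.+1) (iota 0 n); rewrite size_iota; lia.
Qed.

Lemma swap_swap m x : swap m (swap m x) = x.
Proof. by rewrite /swap; do ! case: eqP; lia. Qed.

Lemma swap_lt m x n : m.+1 < n -> x < n -> swap m x < n.
Proof. by rewrite /swap; do ! case: eqP; lia. Qed.

Lemma perm_map_swap m n : m.+1 < n -> perm_eq (map (swap m) (iota 0 n)) (iota 0 n).
Proof.
move=> h; apply: uniq_perm; rewrite ?iota_uniq //.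
  rewrite map_inj_uniq ?iota_uniq //; exact: can_inj (swap_swap m).
move=> x; apply/mapP/idP => [[y]|].
  by rewrite !mem_iota !add0n => hy ->; apply: swap_lt.
by rewrite mem_iota add0n => hx; exists (swap m x); rewrite ?swap_swap // mem_iota add0n swap_lt.
Qed.

Lemma count_swap m n (P : pred nat) : m.+1 < n ->
  count (fun k => P (swap m k)) (iota 0 n) = count P (iota 0 n).
Proof.
move=> h; rewrite -(permP (perm_map_swap h) P) count_map; exact: eq_count.
Qed.

Lemma iota_succ a n : map S (iota a n) = iota a.+1 n.
Proof. by rewrite -add1n iotaDl; apply: eq_map. Qed.

Lemma sorting_wordSS n f : sorting_word n.+2 f =
  map S (map S (sorting_word n (fun k => f k.+2)))
  ++ iota 1 (count (fun k => f 1 < f k.+2) (iota 0 n))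
  ++ iota 0 ((f 0 < f 1) + count (fun k => f 0 < f k.+2) (iota 0 n)).
Proof.
rewrite [LHS]/= map_cat iota_succ -catA -(iota_succ 0 n) count_map.
by congr (_ ++ _ ++ iota 0 (_ + _)).
Qed.

(** A swap inside the tail is absorbed by the recursive sort and does not alter how many tail values
    exceed the first one. A swap of the first two values exchanges their insertions. *)
Lemma coxeter_sorting_word p m n f : n <= p -> m.+1 < n -> {in gtn n &, injective f} ->
  coxeter p (m :: sorting_word n (f \o swap m)) (sorting_word n f).
Proof.
elim: n m p f => // n IH [|m] p f np mn fI.
  case: n IH np mn fI => // n IH np _ fI.
  rewrite !sorting_wordSS.
  set X := map S (map S (sorting_word n (fun k => f k.+2))).
  set kb := count (fun k => f 1 < f k.+2) (iota 0 n).
  set ka := count (fun k => f 0 < f k.+2) (iota 0 n).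
  change (coxeter p (0 :: X ++ iota 1 ka ++ iota 0 ((f 1 < f 0) + kb))
                (X ++ iota 1 kb ++ iota 0 ((f 0 < f 1) + ka))).
  have hX : in_range p X.
    apply/allP => x /mapP [y /mapP [z hz ->] ->].
    have /allP /(_ _ hz) := in_range_sorting_word n (fun k => f k.+2); lia.
  have hkb : kb <= n by rewrite -[n in _ <= n](size_iota 0) count_size.
  have hka : ka <= n by rewrite -[n in _ <= n](size_iota 0) count_size.
  have hX0 : coxeter p (0 :: X) (X ++ [:: 0]).
    rewrite cats1; apply: coxeter_comm => //; first lia.
    by apply/allP => x /mapP [y /mapP [z hz ->] ->].
  apply: coxeter_trans (coxeter_ctx [::] _ hX0) _.
  rewrite /= -catA; apply: (coxeter_cat (coxeter_refl p X)).
  have f01 : f 0 != f 1 by apply/eqP => /fI; rewrite !inE => /(_ isT isT).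
  (* If f 0 < f 1, every later value above f 1 is also above f 0, so the run lengths are comparable
     and one exchange suffices. In the opposite case the exchange leaves a pair 0, 0 to cancel. *)
  have [lt|gt|e] := ltngtP (f 0) (f 1); last by rewrite e eqxx in f01.
    have le : kb <= ka by apply: sub_count => k /=; apply: ltn_trans.
    by rewrite /= !add0n; apply: (@coxeter_run p ka kb); lia.
  have le : ka <= kb by apply: sub_count => k /=; apply: ltn_trans.
  rewrite /= !add0n.
  apply: coxeter_trans (_ : coxeter p ([:: 0; 0] ++ iota 1 kb ++ iota 0 ka) _); last first.
    by apply: (@coxeter_inv p [::]); lia.
  apply: (coxeter_cat (coxeter_refl p [:: 0])); apply: coxeter_sym.
  by apply: (@coxeter_run p kb ka); lia.
rewrite [sorting_word n.+1 _]/= [sorting_word n.+1 f]/=.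
rewrite (_ : count _ _ = count (fun k => f 0 < f (swap m k).+1) (iota 0 n)); last first.
  apply: eq_count => k /=; rewrite {1}/swap /=; congr (_ < f _).
  by rewrite /swap; do ! case: eqP; lia.
rewrite (count_swap (fun k => f 0 < f k.+1)) //.
rewrite -cat_cons; apply: coxeter_cat (coxeter_refl _ _).
rewrite (eq_sorting_word (g := (fun k => f k.+1) \o swap m)); last first.
  by move=> k _ /=; congr f; rewrite /swap; do ! case: eqP; lia.
case: p np => // p np.
apply: (@coxeter_map p (m :: _)); apply: IH => // x y hx hy /fI h.
by have /= := h hx hy; case.
Qed.

Lemma act_lt w x n : in_range n w -> x < n -> act w x < n.
Proof. by elim: w x => //= m w IH x /andP[hm hw] hx; apply: IH => //; apply: swap_lt. Qed.

Lemma act_cat u v x : act (u ++ v) x = act v (act u x).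
Proof. exact: foldl_cat. Qed.

Lemma act_rcons u m x : act (rcons u m) x = swap m (act u x).
Proof. by rewrite -cats1 act_cat. Qed.

Lemma act_rev w x : act (rev w) (act w x) = x.
Proof. by elim: w x => //= m w IH x; rewrite rev_cons act_rcons IH swap_swap. Qed.

Lemma act_revK w x : act w (act (rev w) x) = x.
Proof. by rewrite -{1}(revK w) act_rev. Qed.

(** Let the strands carry the values [f]; then [f \o act (rev w)] is their arrangement on leaving
    [w]. Running [w] and sorting afterwards amounts to sorting at once, as absorbing the letters of
    [w] one at a time shows. *)
Lemma coxeter_normal p w f : in_range p w -> {in gtn p &, injective f} ->
  coxeter p w (sorting_word p f ++ rev (sorting_word p (f \o act (rev w)))).
Proof.
elim: w f => [|m w IH] f /=.
  by move=> _ _; apply: coxeter_sym; apply: coxeter_rev; apply: in_range_sorting_word.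
case/andP=> hm hw fI.
have fI' : {in gtn p &, injective (f \o swap m)}.
  move=> x y hx hy /fI h; apply: (can_inj (swap_swap m)); apply: h; exact: swap_lt.
have h := coxeter_ctx [:: m] [::] (IH _ hw fI'); rewrite !cats0 in h.
apply: coxeter_trans h _; rewrite catA.
have -> : sorting_word p (f \o act (rev (m :: w))) = sorting_word p ((f \o swap m) \o act (rev w)).
  by apply: eq_sorting_word => k _ /=; rewrite rev_cons act_rcons.
apply: coxeter_cat (coxeter_refl _ _); exact: coxeter_sorting_word.
Qed.

(** The order is decreasing, so a smallest value already in last place is never passed. *)
Lemma sorting_word_min n f : {in gtn n, forall k, f n <= f k} -> sorting_word n.+1 f = sorting_word n f.
Proof.
elim: n f => // n IH f h.
have e : iota 0 n.+1 = iota 0 n ++ [:: n] by rewrite -addn1 iotaD.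
rewrite -[sorting_word n.+2 f]/(map S (sorting_word n.+1 (fun k => f k.+1))
  ++ iota 0 (count (fun k => f 0 < f k.+1) (iota 0 n.+1))).
rewrite IH; last by move=> k hk; apply: h.
by rewrite e count_cat /= [f 0 < _]ltnNge h // !addn0.
Qed.

(** * Flat codes of closures and their descending diagrams *)

Definition flat_gcode := seq (nat * bool).

(* [z] is a word of labelled crossings; [true] marks the strand going from
   position m to m.+1. *)
Fixpoint flat_pass (z : seq (nat * nat)) (x : nat) : flat_gcode :=
  if z is ml :: z' then
    if x == ml.1 then (ml.2, true) :: flat_pass z' ml.1.+1
    else if x == ml.1.+1 then (ml.2, false) :: flat_pass z' ml.1
    else flat_pass z' x
  else [::].

(* The return arcs; the one from position 0 crosses all others virtually. *)
Definition return_pos (p y : nat) : nat := if y is y'.+1 then y' else p.-1.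

Definition turn (p : nat) (w : seq nat) (x : nat) : nat := return_pos p (act w x).

(** The base point is at the bottom position, where the return arc from position 0 ends. Cutting
    there opens the closure into the arc that is to be pulled tight. *)
Definition pass_starts (p : nat) (w : seq nat) : seq nat := traject (turn p w) p.-1 p.

Definition flat_code (p : nat) (z : seq (nat * nat)) : flat_gcode :=
  flatten [seq flat_pass z x | x <- pass_starts p (unzip1 z)].

Definition one_cycle (p : nat) (w : seq nat) : Prop :=
  perm_eq (pass_starts p w) (iota 0 p) /\ iter p (turn p w) p.-1 = p.-1.

(* The descending diagram of a flat code: the first passage of each crossing
   is over. *)
Fixpoint mark (S : seq nat) (F : flat_gcode) : gcode :=
  if F is (c, d) :: F' then
    (c, c \notin S, (c \notin S) == d) :: mark (c :: S) F'
  else [::].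

Definition flat_labels (F : flat_gcode) : seq nat := map fst F.

Lemma flat_pass_cat u v x : flat_pass (u ++ v) x = flat_pass u x ++ flat_pass v (act (unzip1 u) x).
Proof.
elim: u x => //= -[m l] u IH x /=; rewrite !IH /swap.
by case: eqP => // _; case: eqP.
Qed.

Lemma flat_labels_flat_pass z x : {subset flat_labels (flat_pass z x) <= unzip2 z}.
Proof.
elim: z x => //= -[m l] z IH x c /= h; rewrite inE; move: h.
case: (x == m); last case: (x == m.+1); last by move/IH ->; rewrite orbT.
  by rewrite inE => /orP[->|/IH ->] //; rewrite orbT.
by rewrite inE => /orP[->|/IH ->] //; rewrite orbT.
Qed.

Lemma eq_mark S S' F : {in flat_labels F, forall c, (c \in S) = (c \in S')} ->
  mark S F = mark S' F.
Proof.
elim: F S S' => //= -[c d] F IH S S' h.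
have hc : (c \in S) = (c \in S') by apply: h; rewrite /= mem_head.
rewrite hc; congr (_ :: _); apply: IH => e he; rewrite !inE.
by case: eqP => //= _; apply: h; rewrite /= inE he orbT.
Qed.

Lemma mark_cat S F G : mark S (F ++ G) = mark S F ++ mark (flat_labels F ++ S) G.
Proof.
elim: F S => //= -[c d] F IH S /=; rewrite IH; congr (_ :: _ ++ _).
by apply: eq_mark => e _; rewrite !(inE, mem_cat); do ! case: (_ \in _); rewrite ?orbT.
Qed.

Lemma labels_mark S F : labels (mark S F) = flat_labels F.
Proof. by elim: F S => //= -[c d] F IH S; rewrite -(IH (c :: S)). Qed.

Lemma vequiv_sym x y : vequiv x y -> vequiv y x.
Proof. exact: rst_sym. Qed.

Lemma vequiv_trans y x z : vequiv x y -> vequiv y z -> vequiv x z.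
Proof. exact: rst_trans. Qed.

Lemma mark_R2 U V W a b d : a != b ->
  a \notin flat_labels (U ++ V ++ W) -> b \notin flat_labels (U ++ V ++ W) ->
  vequiv (mark [::] (U ++ V ++ W))
    (mark [::] (U ++ [:: (a, d); (b, ~~ d)] ++ V ++ [:: (a, ~~ d); (b, d)] ++ W)).
Proof.
move=> ab ha hb; have ba : b == a = false by rewrite eq_sym (negbTE ab).
rewrite !mark_cat.
have := ha; have := hb; rewrite /flat_labels !map_cat !mem_cat !negb_or.
move=> /and3P[bU bV bW] /and3P[aU aV aW].
set S2 := flat_labels [:: (a, d); _] ++ _.
have -> : mark S2 V = mark (flat_labels U ++ [::]) V.
  apply: eq_mark => c hc; rewrite /S2 /= !inE !mem_cat.
  have [ca|] := eqVneq c a; first by rewrite -ca hc in aV.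
  by have [cb|] := eqVneq c b; first by rewrite -cb hc in bV.
set S3 := flat_labels V ++ S2; set S4 := flat_labels [:: (a, ~~ d); _] ++ _.
have -> : mark S4 W = mark (flat_labels V ++ flat_labels U ++ [::]) W.
  apply: eq_mark => c hc; rewrite /S4 /S3 /S2 /= !(inE, mem_cat).
  have [ca|] := eqVneq c a; first by rewrite -ca hc in aW.
  by have [cb|] := eqVneq c b; first by rewrite -cb hc in bW.
have -> : mark (flat_labels U ++ [::]) [:: (a, d); (b, ~~ d)] = [:: (a, true, d); (b, true, ~~ d)].
  by rewrite /= !inE cats0 (negbTE aU) (negbTE bU) ba; case: (d).
have -> : mark S3 [:: (a, ~~ d); (b, d)] = [:: (a, false, d); (b, false, ~~ d)].
  by rewrite /= !(inE, mem_cat) !eqxx !orbT; case: (d).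
apply: rst_step; apply: (gm_R2 (c := a) (d := b) (o := true) (s := d)) => //.
  by rewrite /labels !map_cat -!/(labels _) !labels_mark -!map_cat.
by rewrite /labels !map_cat -!/(labels _) !labels_mark -!map_cat.
Qed.

Lemma perm_eq3 (T : eqType) (x y z a b c : T) :
  perm_eq [:: x; y; z] [:: a; b; c] ->
  [\/ [\/ [:: x; y; z] = [:: a; b; c], [:: x; y; z] = [:: a; c; b] |
       [:: x; y; z] = [:: b; a; c]],
      [:: x; y; z] = [:: b; c; a], [:: x; y; z] = [:: c; a; b] |
      [:: x; y; z] = [:: c; b; a]].
Proof.
move=> h; have : x \in [:: a; b; c] by rewrite -(perm_mem h) mem_head.
rewrite !inE => /or3P[] /eqP e; subst x.
- move: h; rewrite perm_cons => /perm_eq2 [[-> ->]|[-> ->]];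
  by [apply: Or41; apply: Or31 | apply: Or41; apply: Or32].
- move: h; rewrite perm_sym (perm_catCA [:: a] [:: b] [:: c]) perm_sym perm_cons.
  by case/perm_eq2 => [[-> ->]|[-> ->]];
  [apply: Or41; apply: Or33 | apply: Or42].
- move: h; rewrite perm_sym (perm_catC [:: a; b] [:: c]) perm_sym perm_cons.
  by case/perm_eq2 => [[-> ->]|[-> ->]]; [apply: Or43 | apply: Or44].
Qed.

(** Descending order stacks the three segments as they are visited, the first on top, so the
    triangle is an R3 configuration whatever the order of the visits. *)
Lemma mark_R3 (a b c : nat) (U0 U1 U2 U3 T0 T1 T2 : flat_gcode) :
  uniq [:: a; b; c] ->
  {in [:: a; b; c], forall d, d \notin flat_labels (U0 ++ U1 ++ U2 ++ U3)} ->
  perm_eq [:: T0; T1; T2]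
    [:: [:: (a, true); (b, true)]; [:: (a, false); (c, true)]; [:: (b, false); (c, false)]] ->
  vequiv (mark [::] (U0 ++ T0 ++ U1 ++ T1 ++ U2 ++ T2 ++ U3))
         (mark [::] (U0 ++ rev T0 ++ U1 ++ rev T1 ++ U2 ++ rev T2 ++ U3)).
Proof.
rewrite /= !inE !andbT negb_or => /andP[/andP[ab ac] bc] hU hT.
have ba : b != a by rewrite eq_sym.
have ca : c != a by rewrite eq_sym.
have cb : c != b by rewrite eq_sym.
have hl (T : flat_gcode) : T \in [:: T0; T1; T2] -> {subset flat_labels T <= [:: a; b; c]}.
  rewrite (perm_mem hT) !inE => hT' d; move: hT'.
  by case/or3P => /eqP -> /=; rewrite !inE => /orP[] /eqP ->; rewrite eqxx ?orbT.
have h0 := hl T0 (mem_head _ _).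
have h1 := hl T1 (mem_behead (s := [:: _; T1; T2]) (mem_head _ _)).
have h2 := hl T2 (mem_behead (s := [:: _; T1; T2]) (mem_behead (s := [:: T1; T2]) (mem_head _ _))).
have Tn T d : {subset flat_labels T <= [:: a; b; c]} ->
    d \in flat_labels (U0 ++ U1 ++ U2 ++ U3) -> (d \in flat_labels T) = false.
  by move=> hs hd; apply/negP => /hs /hU; rewrite hd.
(* Marks depend only on the set of labels seen earlier, so rearranging letters inside the three
   segments does not affect the marks outside them. *)
have key V0 V1 V2 : (flat_labels V0 =i flat_labels T0) -> (flat_labels V1 =i flat_labels T1) ->
    (flat_labels V2 =i flat_labels T2) ->
    mark [::] (U0 ++ V0 ++ U1 ++ V1 ++ U2 ++ V2 ++ U3) =
    mark [::] U0 ++ mark [::] V0 ++ mark (flat_labels U0) U1 ++ mark (flat_labels T0) V1 ++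
    mark (flat_labels U0 ++ flat_labels U1) U2 ++ mark (flat_labels T0 ++ flat_labels T1) V2 ++
    mark (flat_labels U0 ++ flat_labels U1 ++ flat_labels U2) U3.
  move=> e0 e1 e2; rewrite !mark_cat !cats0.
  have nU d : d \in [:: a; b; c] -> [/\ (d \in flat_labels U0) = false, (d \in flat_labels U1) = false,
     (d \in flat_labels U2) = false & (d \in flat_labels U3) = false].
    move=> /hU; rewrite /flat_labels !map_cat !mem_cat !negb_or.
    by case/and4P => *; split; apply: negbTE.
  have nV d : d \in flat_labels (U0 ++ U1 ++ U2 ++ U3) -> [/\ (d \in flat_labels T0) = false,
      (d \in flat_labels T1) = false & (d \in flat_labels T2) = false].
    by move=> hd; split; apply: Tn.
  congr (_ ++ _ ++ _ ++ _ ++ _ ++ _ ++ _); apply: eq_mark => d hd; rewrite ?mem_cat ?e0 ?e1 ?e2.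
  - by have [|-> _ _ _] := nU d; first by apply: h0; rewrite -e0.
  - have [|-> _ _] := nV d; last by [].
    by rewrite /flat_labels !map_cat !mem_cat hd !orbT.
  - have [|-> -> _ _] := nU d; first by apply: h1; rewrite -e1.
    by rewrite orbF.
  - have [|-> -> _] := nV d; last by rewrite /= orbC.
    by rewrite /flat_labels !map_cat !mem_cat hd !orbT.
  - have [|-> -> -> _] := nU d; first by apply: h2; rewrite -e2.
    by rewrite /= orbF orbC.
  - have [|-> -> ->] := nV d; last by do ! case: (d \in _).
    by rewrite /flat_labels !map_cat !mem_cat hd !orbT.
have rv (V : flat_gcode) : flat_labels (rev V) =i flat_labels V.
  by move=> d; rewrite /flat_labels map_rev mem_rev.
rewrite !key //.
have rm S (T : flat_gcode) x y : x.1 != y.1 -> T = [:: x; y] -> mark S (rev T) = rev (mark S T).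
  move=> + ->; case: x => x1 x2; case: y => y1 y2 /= xy.
  by rewrite /rev /= !inE [y1 == x1]eq_sym (negbTE xy).
have rmT S (T : flat_gcode) : T \in [:: T0; T1; T2] -> mark S (rev T) = rev (mark S T).
  by rewrite (perm_mem hT) !inE => /or3P[] /eqP ->; apply: (rm _ _ _ _ _ erefl).
rewrite !rmT ?inE ?eqxx ?orbT //.
apply: rst_step; apply: gm_R3; last first.
  apply/allP => d; rewrite /labels !map_cat -!/(labels _) !labels_mark !mem_cat => hd.
  have {}hd : d \in [:: a; b; c] by case/or3P: hd; [apply: h0|apply: h1|apply: h2].
  by have := hU d hd; rewrite /flat_labels !map_cat !mem_cat.
have sol (w : bool) (k l01 l02 l12 : nat) S0 S1 S2 : uniq [:: l01; l02; l12] ->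
  let e := fun i => i != k in let h := fun i => 2 - i in
  let l := fun i j => nth l12 [:: l12; l01; l02] (i + j) in
  S0 = r3seg w e h l 0 -> S1 = r3seg w e h l 1 -> S2 = r3seg w e h l 2 -> R3config S0 S1 S2.
  move=> ul e h l *; exists w, e, h, l; split=> // i j.
  by rewrite /l addnC.
case: (perm_eq3 hT) => [[]|||] [-> -> ->].
- apply: (sol false 1 a b c); rewrite /= ?inE ?negb_or ?ab ?ac ?bc ?ba ?ca ?cb ?eqxx //.
- apply: (sol true 2 b a c); rewrite /= ?inE ?negb_or ?ab ?ac ?bc ?ba ?ca ?cb ?eqxx //.
- apply: (sol true 0 a c b); rewrite /= ?inE ?negb_or ?ab ?ac ?bc ?ba ?ca ?cb ?eqxx //.
- apply: (sol false 0 c a b); rewrite /= ?inE ?negb_or ?ab ?ac ?bc ?ba ?ca ?cb ?eqxx //.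
- apply: (sol false 2 b c a); rewrite /= ?inE ?negb_or ?ab ?ac ?bc ?ba ?ca ?cb ?eqxx //.
- apply: (sol true 1 c b a); rewrite /= ?inE ?negb_or ?ab ?ac ?bc ?ba ?ca ?cb ?eqxx //.
Qed.

(** * Coxeter relations as Reidemeister moves of descending diagrams *)

Lemma filter_split (T : eqType) (P : pred T) (s t : seq T) y :
  filter P s = y :: t ->
  exists s1 s2, [/\ s = s1 ++ y :: s2, filter P s1 = [::] & filter P s2 = t].
Proof.
elim: s => //= x s IH; case: ifP => hx.
  by case=> <- <-; exists [::], s.
by case/IH => s1 [s2 [-> h1 h2]]; exists (x :: s1), s2; rewrite /= hx.
Qed.

Lemma map_cat_split (A B : Type) (f : A -> B) z u v : map f z = u ++ v ->
  exists z1 z2, [/\ z = z1 ++ z2, map f z1 = u & map f z2 = v].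
Proof.
move=> h; exists (take (size u) z), (drop (size u) z); split; first by rewrite cat_take_drop.
  by rewrite map_take h take_size_cat.
by rewrite map_drop h drop_size_cat.
Qed.

Lemma coxeter_act p w w' : coxeter p w w' -> act w =1 act w'.
Proof.
elim=> {w w'} [w|w w' _ IH|w2 w1 w3 _ IH1 _ IH2|u v m n h1 h2|u v m h|u v m h] x.
- by [].
- by rewrite IH.
- by rewrite IH1.
- rewrite !act_cat /=; congr (act v _); move: (act u x) => y.
  by rewrite /swap; do ! case: eqP; lia.
- rewrite !act_cat /=; congr (act v _); move: (act u x) => y.
  by rewrite /swap; do ! case: eqP; lia.
- by rewrite !act_cat /= swap_swap.
Qed.

Lemma coxeter_in_range p w w' : coxeter p w w' -> in_range p w = in_range p w'.
Proof.
rewrite /in_range.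
elim=> {w w'} [w|w w' _ IH|w2 w1 w3 _ IH1 _ IH2|u v m n h1 h2|u v m h|u v m h];
  rewrite ?all_cat /= //.
- by rewrite IH1.
- by congr (_ && _); rewrite andbCA.
- by rewrite h (ltnW h).
- by rewrite h.
Qed.

Lemma eq_turn p w w' : act w =1 act w' -> turn p w =1 turn p w'.
Proof. by move=> h x; rewrite /turn h. Qed.

Lemma eq_pass_starts p w w' : act w =1 act w' -> pass_starts p w = pass_starts p w'.
Proof.
move=> /(eq_turn p) h; rewrite /pass_starts.
by move: p.-1 => x; elim: {2 4}p x => //= n IH x; rewrite h IH.
Qed.

Lemma eq_one_cycle p w w' : act w =1 act w' -> one_cycle p w -> one_cycle p w'.
Proof.
move=> h [h1 h2]; split; first by rewrite -(eq_pass_starts p h).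
by rewrite -{2}h2; apply: eq_iter => x; rewrite (eq_turn p h).
Qed.

Lemma perm_map_act p w : in_range p w -> perm_eq (map (act w) (iota 0 p)) (iota 0 p).
Proof.
elim: w => [|m w IH] /=; first by rewrite map_id.
move=> /andP[hm /IH h]; apply: perm_trans h.
rewrite (eq_map (g := act w \o swap m)) // map_comp.
by apply: perm_map; apply: perm_map_swap.
Qed.

(** At a given place of the word each position is met by exactly one pass. A local relation thus
    involves two or three passes, whose order in time is not known. *)
Lemma perm_act_filter p w X s : in_range p w -> perm_eq X (iota 0 p) -> uniq s ->
  {in s, forall k, k < p} ->
  perm_eq (map (act w) (filter (fun x => act w x \in s) X)) s.
Proof.
move=> hw hX us hs.
rewrite -(filter_map (act w) (mem s)).
apply: perm_trans (perm_filter (mem s) (perm_trans (perm_map (act w) hX) (perm_map_act hw))) _.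
apply: uniq_perm => //; first by rewrite filter_uniq ?iota_uniq.
move=> k; rewrite mem_filter mem_iota /=.
by case hk: (k \in s) => //=; rewrite hs.
Qed.

(** Used to split every pass around the factor of the word being rewritten, with [mid] the stretch
    inside that factor. *)
Definition weave (f g : nat -> flat_gcode) (mid : nat -> flat_gcode) (X : seq nat) : flat_gcode :=
  flatten [seq f x ++ mid x ++ g x | x <- X].

Lemma weave_cat f g mid X Y : weave f g mid (X ++ Y) = weave f g mid X ++ weave f g mid Y.
Proof. by rewrite /weave map_cat flatten_cat. Qed.

Lemma weave_cons f g mid x X :
  weave f g mid (x :: X) = f x ++ mid x ++ g x ++ weave f g mid X.
Proof. by rewrite /weave /= -!catA. Qed.

Lemma eq_weave f g g' mid mid' (P : pred nat) X : g =1 g' ->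
  (forall x, ~~ P x -> mid x = mid' x) -> filter P X = [::] ->
  weave f g mid X = weave f g' mid' X.
Proof.
move=> hg h; elim: X => //= x X IH; case: ifP => // hx hX.
by rewrite !weave_cons IH // h ?hx // hg.
Qed.

Lemma flat_code_weave p zu zL zv :
  flat_code p (zu ++ zL ++ zv) =
  weave (flat_pass zu) (fun x => flat_pass zv (act (unzip1 zu ++ unzip1 zL) x))
    (fun x => flat_pass zL (act (unzip1 zu) x)) (pass_starts p (unzip1 (zu ++ zL ++ zv))).
Proof.
rewrite /flat_code /weave; congr flatten; apply: eq_map => x.
by rewrite !flat_pass_cat act_cat.
Qed.

Lemma flat_labels_flat_code p z : {subset flat_labels (flat_code p z) <= unzip2 z}.
Proof.
rewrite /flat_code; move: (pass_starts _ _) => X c.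
elim: X => //= x X IH; rewrite /flat_labels map_cat mem_cat => /orP[/flat_labels_flat_pass|/IH] //.
Qed.

Lemma unzip1_cat (A B : Type) (s t : seq (A * B)) : unzip1 (s ++ t) = unzip1 s ++ unzip1 t.
Proof. exact: map_cat. Qed.

Lemma unzip2_cat (A B : Type) (s t : seq (A * B)) : unzip2 (s ++ t) = unzip2 s ++ unzip2 t.
Proof. exact: map_cat. Qed.

Lemma vequiv_inv p zu zv m a b :
  m.+1 < p -> in_range p (unzip1 zu) -> one_cycle p (unzip1 (zu ++ zv)) ->
  uniq (a :: b :: unzip2 (zu ++ zv)) ->
  vequiv (mark [::] (flat_code p (zu ++ zv)))
         (mark [::] (flat_code p (zu ++ [:: (m, a); (m, b)] ++ zv))).
Proof.
set zL := [:: (m, a); (m, b)].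
move=> hm hu [hX _]; rewrite cons_uniq inE negb_or => /andP[/andP[ab ha]].
rewrite cons_uniq => /andP[hb _].
have hla : a \notin flat_labels (flat_code p (zu ++ zv)) by apply: contra ha => /flat_labels_flat_code.
have hlb : b \notin flat_labels (flat_code p (zu ++ zv)) by apply: contra hb => /flat_labels_flat_code.
move: hX hla hlb; pose X := pass_starts p (unzip1 (zu ++ zv)); pose f := flat_pass zu.
pose g x := flat_pass zv (act (unzip1 zu ++ [::]) x); pose mid (x : nat) : flat_gcode := [::].
pose g' x := flat_pass zv (act (unzip1 zu ++ unzip1 zL) x).
pose mid' x := flat_pass zL (act (unzip1 zu) x).
have -> : flat_code p (zu ++ zv) = weave f g mid X := flat_code_weave p zu [::] zv.
have -> : flat_code p (zu ++ zL ++ zv) = weave f g' mid' X.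
  rewrite flat_code_weave; congr weave; apply: eq_pass_starts => x.
  by rewrite !unzip1_cat !act_cat /= swap_swap.
have gg : g' =1 g by move=> x; rewrite /g /g' !act_cat /= swap_swap.
move=> hX hla hlb.
pose P x := act (unzip1 zu) x \in [:: m; m.+1].
have hmid x : ~~ P x -> mid' x = mid x.
  by rewrite /P !inE /mid' /mid /= => /norP[/negbTE -> /negbTE ->].
have hPX : perm_eq (map (act (unzip1 zu)) (filter P X)) [:: m; m.+1].
  by apply: (perm_act_filter hu hX) => [|k]; rewrite /= !inE; lia.
case E : (filter P X) hPX => [|x1 [|x2 [|? ?]]] /= hPX; try by have := perm_size hPX.
have [X1 [X' [eX e1 eX']]] := filter_split E.
have [X2 [X3 [eX'' e2 e3]]] := filter_split eX'.
have /= hd := perm_eq2 hPX.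
(* Either of the two strands may come first; [d] is the direction in which the first one enters the
   bigon. *)
have [d [m1 m2]] : exists d, mid' x1 = [:: (a, d); (b, ~~ d)] /\ mid' x2 = [:: (a, ~~ d); (b, d)].
  rewrite /mid' /=; case: hd => -[-> ->]; [exists true | exists false];
    by rewrite !eqxx !(gtn_eqF (ltnSn m)).
have e0 : weave f g mid X = (weave f g mid X1 ++ f x1) ++
    (g x1 ++ weave f g mid X2 ++ f x2) ++ (g x2 ++ weave f g mid X3).
  by rewrite eX eX'' !(weave_cat, weave_cons) /mid /= -!catA.
have e0' : weave f g' mid' X = (weave f g mid X1 ++ f x1) ++ [:: (a, d); (b, ~~ d)] ++
    (g x1 ++ weave f g mid X2 ++ f x2) ++ [:: (a, ~~ d); (b, d)] ++ (g x2 ++ weave f g mid X3).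
  rewrite eX eX'' !(weave_cat, weave_cons) m1 m2 !(eq_weave f gg hmid) // !gg.
  by rewrite -!catA.
by rewrite e0'; move: hla hlb; rewrite e0; apply: mark_R2.
Qed.

(** No strand runs through both crossings of the pair, so the codes agree letter for letter and no
    move is made. *)
Lemma flat_code_far p zu zv m n a b : m.+1 < n ->
  flat_code p (zu ++ [:: (m, a); (n, b)] ++ zv) = flat_code p (zu ++ [:: (n, b); (m, a)] ++ zv).
Proof.
move=> h; rewrite !flat_code_weave /weave.
have sE y : act [:: m; n] y = act [:: n; m] y.
  by rewrite /= /swap; do ! case: eqP; lia.
have -> : pass_starts p (unzip1 (zu ++ [:: (m, a); (n, b)] ++ zv)) =
          pass_starts p (unzip1 (zu ++ [:: (n, b); (m, a)] ++ zv)).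
  apply: eq_pass_starts => x; rewrite !unzip1_cat !act_cat; congr (act _ _).
  exact: sE.
congr flatten; apply: eq_map => x; rewrite !act_cat sE; congr (_ ++ _ ++ _).
move: (act (unzip1 zu) x) => y /=.
have e1 : m.+1 == n = false by lia.
have e2 : n == m = false by lia.
have e3 : n == m.+1 = false by lia.
have e4 : n.+1 == m = false by lia.
have e5 : m == n = false by lia.
have e6 : m == n.+1 = false by lia.
have e7 : n.+1 == m.+1 = false by lia.
have e8 : m.+1 == n.+1 = false by lia.
case hy1 : (y == m); first by rewrite ?(eqP hy1, e1, e2, e3, e4, e5, e6, e7, e8, eqxx).
case hy2 : (y == m.+1); first by rewrite ?(eqP hy2, e1, e2, e3, e4, e5, e6, e7, e8, eqxx).
case hy3 : (y == n); first by rewrite ?(eqP hy3, e1, e2, e3, e4, e5, e6, e7, e8, eqxx).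
case hy4 : (y == n.+1); first by rewrite ?(eqP hy4, e1, e2, e3, e4, e5, e6, e7, e8, eqxx).
by rewrite ?(hy1, hy2, hy3, hy4).
Qed.

(** The labels on the right are placed so that each of the three passes reads its stretch backwards,
    which is how R3 acts on a Gauss code. *)
Lemma vequiv_braid p zu zv m a b c :
  m.+2 < p -> in_range p (unzip1 zu) ->
  one_cycle p (unzip1 (zu ++ [:: (m, a); (m.+1, b); (m, c)] ++ zv)) ->
  uniq (a :: b :: c :: unzip2 (zu ++ zv)) ->
  vequiv (mark [::] (flat_code p (zu ++ [:: (m, a); (m.+1, b); (m, c)] ++ zv)))
         (mark [::] (flat_code p (zu ++ [:: (m.+1, c); (m, b); (m.+1, a)] ++ zv))).
Proof.
set zL := [:: _; _; _]; set zR := [:: _; _; _].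
move=> hm hu [hX _] hun.
pose X := pass_starts p (unzip1 (zu ++ zL ++ zv)); pose f := flat_pass zu.
pose g x := flat_pass zv (act (unzip1 zu ++ unzip1 zL) x).
pose g' x := flat_pass zv (act (unzip1 zu ++ unzip1 zR) x).
pose mid x := flat_pass zL (act (unzip1 zu) x).
pose mid' x := flat_pass zR (act (unzip1 zu) x).
have sE y : act (unzip1 zL) y = act (unzip1 zR) y.
  by rewrite /= /swap; do ! case: eqP; lia.
have -> : flat_code p (zu ++ zL ++ zv) = weave f g mid X := flat_code_weave p zu zL zv.
have -> : flat_code p (zu ++ zR ++ zv) = weave f g' mid' X.
  rewrite flat_code_weave; congr weave; apply: eq_pass_starts => x.
  by rewrite !unzip1_cat !act_cat sE.
have gg : g =1 g' by move=> x; rewrite /g /g' !act_cat sE.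
pose P x := act (unzip1 zu) x \in [:: m; m.+1; m.+2].
have e1 : m.+1 == m = false by lia.
have e2 : m.+2 == m = false by lia.
have e3 : m.+2 == m.+1 = false by lia.
have e4 : m == m.+1 = false by lia.
have e5 : m == m.+2 = false by lia.
have e6 : m.+1 == m.+2 = false by lia.
pose ee := (e1, e2, e3, e4, e5, e6, eqxx).
have hmid0 x : ~~ P x -> mid x = [::].
  rewrite /P !inE /mid /= => /norP[/negbTE h1 /norP[/negbTE h2 /negbTE h3]].
  by rewrite ?(h1, h2, h3).
have hmid0' x : ~~ P x -> mid' x = [::].
  rewrite /P !inE /mid' /= => /norP[/negbTE h1 /norP[/negbTE h2 /negbTE h3]].
  by rewrite ?(h1, h2, h3).
have hmid x : ~~ P x -> mid x = mid' x by move=> hx; rewrite hmid0 ?hmid0'.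
pose T k := flat_pass zL k.
have hrev x : P x -> mid' x = rev (mid x).
  rewrite /P !inE /mid /mid' => /or3P[] /eqP ->; by rewrite /zL /zR /= ?ee.
have hT : [:: T m; T m.+1; T m.+2] =
    [:: [:: (a, true); (b, true)]; [:: (a, false); (c, true)]; [:: (b, false); (c, false)]].
  by rewrite /T /zL /= ?ee /= ?ee.
have hPX : perm_eq (map (act (unzip1 zu)) (filter P X)) [:: m; m.+1; m.+2].
  by apply: (perm_act_filter hu hX) => [|k]; rewrite /= !inE; lia.
have hP3 x : x \in filter P X -> P x by rewrite mem_filter => /andP[].
case E : (filter P X) hPX hP3 => [|x1 [|x2 [|x3 [|? ?]]]] /= hPX hP3;
  try by have := perm_size hPX.
have [X1 [X' [eX n1 eX']]] := filter_split E.
have [X2 [X'' [eX2 n2 eX'']]] := filter_split eX'.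
have [X3 [X4 [eX3 n3 n4]]] := filter_split eX''.
have P1 : P x1 by apply: hP3; rewrite !inE eqxx.
have P2 : P x2 by apply: hP3; rewrite !inE eqxx orbT.
have P3 : P x3 by apply: hP3; rewrite !inE eqxx !orbT.
have e0 : weave f g mid X = (weave f g mid X1 ++ f x1) ++ mid x1 ++
    (g x1 ++ weave f g mid X2 ++ f x2) ++ mid x2 ++
    (g x2 ++ weave f g mid X3 ++ f x3) ++ mid x3 ++ (g x3 ++ weave f g mid X4).
  by rewrite eX eX2 eX3 !(weave_cat, weave_cons) -!catA.
have e0' : weave f g' mid' X = (weave f g mid X1 ++ f x1) ++ rev (mid x1) ++
    (g x1 ++ weave f g mid X2 ++ f x2) ++ rev (mid x2) ++
    (g x2 ++ weave f g mid X3 ++ f x3) ++ rev (mid x3) ++ (g x3 ++ weave f g mid X4).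
  rewrite eX eX2 eX3 !(weave_cat, weave_cons) -!hrev // !(eq_weave f gg hmid) // !gg.
  by rewrite -!catA.
rewrite e0 e0'; apply: (@mark_R3 a b c).
- by move: hun; rewrite /= !inE !negb_or !andbT => /and3P[/and3P[-> -> _] /andP[-> _] _].
- have hsub : {subset flat_labels ((weave f g mid X1 ++ f x1) ++
    (g x1 ++ weave f g mid X2 ++ f x2) ++
    (g x2 ++ weave f g mid X3 ++ f x3) ++ (g x3 ++ weave f g mid X4)) <= unzip2 (zu ++ zv)}.
    have hf x : {subset flat_labels (f x) <= unzip2 (zu ++ zv)}.
      by move=> d /flat_labels_flat_pass; rewrite unzip2_cat mem_cat => ->.
    have hg x : {subset flat_labels (g x) <= unzip2 (zu ++ zv)}.
      by move=> d /flat_labels_flat_pass; rewrite unzip2_cat mem_cat => ->; rewrite orbT.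
    have hw Y : filter P Y = [::] -> {subset flat_labels (weave f g mid Y) <= unzip2 (zu ++ zv)}.
      elim: Y => //= y Y IH; case: ifP => // hy /IH h d.
      rewrite weave_cons hmid0 ?hy //= /flat_labels !map_cat !mem_cat.
      by case/or3P => [/hf|/hg|/h].
    move=> d; rewrite /flat_labels !map_cat !mem_cat -!orbA.
    by do ! case/orP; try by [move/hf | move/hg | move/(hw _ n1) | move/(hw _ n2)
      | move/(hw _ n3) | move/(hw _ n4)].
  move=> d; rewrite !inE => hd; apply/negP => /hsub hd'.
  move: hun; rewrite /= !inE !negb_or => /and4P[/and3P[_ _ na] /andP[_ nb] nc _].
  by case/or3P: hd => /eqP e; rewrite -e hd' in na nb nc.
- rewrite -hT; have := perm_map T hPX; exact.
Qed.

(** All labellings are allowed at once, because braid relations permute labels and inserting m, m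
    introduces fresh ones. *)
Definition trivial_closure (p : nat) (w : seq nat) : Prop :=
  forall z, unzip1 z = w -> uniq (unzip2 z) -> vequiv (mark [::] (flat_code p z)) [::].

Lemma exists_fresh (s : seq nat) : exists a, a \notin s.
Proof.
exists (\max_(i <- s) i).+1; apply/negP => h.
by have := @leq_bigmax_seq _ s xpredT id _ h isT; rewrite ltnn.
Qed.

Lemma coxeter_trivial p w w' : coxeter p w w' -> in_range p w -> one_cycle p w ->
  trivial_closure p w <-> trivial_closure p w'.
Proof.
elim=> {w w'} [w|w w' h IH|w2 w1 w3 h1 IH1 h2 IH2|u v m n h1 h2|u v m h|u v m h] ok cy.
- by [].
- apply: iff_sym; apply: IH; first by rewrite (coxeter_in_range h).
  by apply: eq_one_cycle cy => x; rewrite (coxeter_act h).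
- apply: iff_trans (IH1 ok cy) _; apply: IH2; first by rewrite -(coxeter_in_range h1).
  by apply: eq_one_cycle cy => x; rewrite (coxeter_act h1).
- split=> ht z /map_cat_split [zu [z' [-> eu /map_cat_split [zL [zv [-> eL ev]]]]]];
  case: zL eL => [|[x a] [|[y b] [|? ?]]] //= [? ?]; subst x y => hun.
    rewrite -[_ :: _]/([:: (n, a); (m, b)] ++ zv) -flat_code_far //; apply: ht.
      by rewrite !unzip1_cat /= -eu -ev.
    rewrite (perm_uniq (s2 := unzip2 (zu ++ [:: (n, a), (m, b) & zv]))) //.
    by apply/permP => P; rewrite !unzip2_cat !count_cat /=; lia.
  rewrite -[_ :: _]/([:: (m, a); (n, b)] ++ zv) flat_code_far //; apply: ht.
    by rewrite !unzip1_cat /= -eu -ev.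
  rewrite (perm_uniq (s2 := unzip2 (zu ++ [:: (m, a), (n, b) & zv]))) //.
  by apply/permP => P; rewrite !unzip2_cat !count_cat /=; lia.
- split=> ht z /map_cat_split [zu [z' [-> eu /map_cat_split [zL [zv [-> eL ev]]]]]];
  case: zL eL => [|[x a] [|[y b] [|[t c] [|? ?]]]] //= [? ? ?]; subst x y t => hun.
    have cy' : one_cycle p (unzip1 (zu ++ [:: (m, c); (m.+1, b); (m, a)] ++ zv)).
      by move: cy; rewrite !unzip1_cat -eu -ev.
    have hun' : uniq (c :: b :: a :: unzip2 (zu ++ zv)).
      rewrite -(perm_uniq (s1 := unzip2 (zu ++ [:: (m.+1, a), (m, b), (m.+1, c) & zv]))) //.
      by apply/permP => P; rewrite /= !unzip2_cat !count_cat /=; lia.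
    apply: vequiv_trans (vequiv_sym (vequiv_braid h _ cy' hun')) _.
      by move: ok; rewrite -eu /in_range all_cat => /andP[].
    apply: ht; first by rewrite !unzip1_cat /= -eu -ev.
    by rewrite -(perm_uniq (s1 := unzip2 (zu ++ [:: (m.+1, a), (m, b), (m.+1, c) & zv]))) //;
      apply/permP => P; rewrite /= !unzip2_cat !count_cat /=; lia.
  have cy' : one_cycle p (unzip1 (zu ++ [:: (m, a); (m.+1, b); (m, c)] ++ zv)).
    by move: cy; rewrite !unzip1_cat -eu -ev.
  have hun' : uniq (a :: b :: c :: unzip2 (zu ++ zv)).
    rewrite -(perm_uniq (s1 := unzip2 (zu ++ [:: (m, a), (m.+1, b), (m, c) & zv]))) //.
    by apply/permP => P; rewrite /= !unzip2_cat !count_cat /=; lia.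
  apply: vequiv_trans (vequiv_braid h _ cy' hun') _.
    by move: ok; rewrite -eu /in_range all_cat => /andP[].
  apply: ht; first by rewrite !unzip1_cat /= -eu -ev.
  by rewrite -(perm_uniq (s1 := unzip2 (zu ++ [:: (m, a), (m.+1, b), (m, c) & zv]))) //;
    apply/permP => P; rewrite /= !unzip2_cat !count_cat /=; lia.
- have cyz (zu zv : seq (nat * nat)) : unzip1 zu = u -> unzip1 zv = v -> one_cycle p (unzip1 (zu ++ zv)).
    move=> eu ev; rewrite unzip1_cat eu ev; apply: eq_one_cycle cy => x.
    by rewrite !act_cat /= swap_swap.
  have oku (zu : seq (nat * nat)) : unzip1 zu = u -> in_range p (unzip1 zu).
    by move=> ->; move: ok; rewrite /in_range all_cat => /andP[].
  split=> ht z /map_cat_split [zu [z' [-> eu]]].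
    move=> ev hun.
    have [a ha] := exists_fresh (unzip2 (zu ++ z')).
    have [b] := exists_fresh (a :: unzip2 (zu ++ z')); rewrite inE negb_or => /andP[hba hb].
    have hun' : uniq (a :: b :: unzip2 (zu ++ z')).
      by rewrite !cons_uniq inE negb_or eq_sym hba ha hb hun.
    apply: vequiv_trans (vequiv_inv h (oku _ eu) (cyz _ _ eu ev) hun') _.
    apply: ht; first by rewrite !unzip1_cat /= -eu -ev.
    rewrite (perm_uniq (s2 := a :: b :: unzip2 (zu ++ z'))) //.
    by apply/permP => P; rewrite /= !unzip2_cat !count_cat /=; lia.
  move=> /map_cat_split [zL [zv [-> eL ev]]].
  case: zL eL => [|[x a] [|[y b] [|? ?]]] //= [? ?]; subst x y => hun.
  have hun' : uniq (a :: b :: unzip2 (zu ++ zv)).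
    rewrite -(perm_uniq (s1 := unzip2 (zu ++ [:: (m, a), (m, b) & zv]))) //.
    by apply/permP => P; rewrite /= !unzip2_cat !count_cat /=; lia.
  apply: vequiv_trans (vequiv_sym (vequiv_inv h (oku _ eu) (cyz _ _ eu ev) hun')) _.
  apply: ht; first by rewrite unzip1_cat -eu -ev.
  by move: hun' => /= /andP[_ /andP[]].
Qed.

(** * Conjugation through the return arcs *)

Lemma turn_conj p w m x : m.+2 < p ->
  turn p (w ++ [:: m.+1]) (swap m x) = swap m (turn p (m :: w) x).
Proof.
move=> h; rewrite /turn act_cat /=; case: (act w _) => [|y] /=.
  by rewrite /swap; do ! case: eqP; lia.
by rewrite /swap !eqSS; case: (y == m) => //; case: (y == m.+1).
Qed.

(** Return arcs lower positions by one, so a letter m slid backwards through them becomes m.+1. The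
    bound on m keeps the bottom starting position fixed. *)
Lemma pass_starts_conj p w m : m.+2 < p ->
  pass_starts p (w ++ [:: m.+1]) = map (swap m) (pass_starts p (m :: w)).
Proof.
move=> h; rewrite /pass_starts.
have e : p.-1 = swap m p.-1 by rewrite /swap; do ! case: eqP; lia.
rewrite {1}e; move: p.-1 => x {e}; elim: {2 4}p x => //= n IH x.
by rewrite turn_conj // IH.
Qed.

Lemma one_cycle_conj p w m : m.+2 < p -> one_cycle p (m :: w) -> one_cycle p (w ++ [:: m.+1]).
Proof.
move=> h [h1 h2]; have e : swap m p.-1 = p.-1 by rewrite /swap; do ! case: eqP; lia.
split.
  rewrite pass_starts_conj //; apply: perm_trans (perm_map (swap m) h1) _.
  by apply: perm_map_swap; lia.
have it n x : iter n (turn p (w ++ [:: m.+1])) (swap m x) = swap m (iter n (turn p (m :: w)) x).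
  by elim: n => //= n ->; apply: turn_conj.
by rewrite -{1}e it h2.
Qed.

(** Equality is claimed, and not only agreement up to rotation, because [mark] depends on the base
    point. Both sides list the same alternation of the moved letter and the remaining stretches,
    since the first pass, entering at the bottom, does not meet that letter. *)
Lemma flat_code_conj p z m l : m.+2 < p -> one_cycle p (m :: unzip1 z) ->
  flat_code p ((m, l) :: z) = flat_code p (z ++ [:: (m.+1, l)]).
Proof.
move=> h [_ h2]; rewrite /flat_code unzip1_cat pass_starts_conj // -map_comp /pass_starts.
pose q x := flat_pass [:: (m, l)] x; pose r x := flat_pass z (swap m x).
set f := turn _ _ in h2 *.
have e1 x : flat_pass ((m, l) :: z) x = q x ++ r x by exact: (flat_pass_cat [:: _]).
have q0 : q p.-1 = [::] by rewrite /q /=; do 2 (case: eqP => //; first lia).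
have e2 x : (flat_pass (z ++ [:: (m.+1, l)]) \o swap m) x = r x ++ q (f x).
  rewrite /= flat_pass_cat; congr (_ ++ _); rewrite /f /turn /=.
  by case: (act _ _) => [|y] //=; rewrite q0.
rewrite (eq_map e1) (eq_map e2).
have key n x : flatten [seq q y ++ r y | y <- traject f x n] ++ q (iter n f x) =
   q x ++ flatten [seq r y ++ q (f y) | y <- traject f x n].
  elim: n x => [|n IH] x /=; first by rewrite cats0.
  by rewrite -iterS iterSr -!catA IH.
by have := key p p.-1; rewrite h2 q0 cats0.
Qed.

(** The first letter m of [A], conjugated to the end, becomes m.+1 and cancels against the last
    letter. *)
Lemma trivial_palindrome p A : all (fun m => m.+2 < p) A ->
  one_cycle p (A ++ rev (map S A)) -> trivial_closure p (A ++ rev (map S A)).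
Proof.
elim: A => [|m A IH] /=.
  move=> _ _ [] //= _ _; rewrite /flat_code /=.
  have -> : flatten [seq flat_pass [::] x | x <- pass_starts p [::]] = [::].
    by elim: (pass_starts _ _).
  exact: rst_refl.
case/andP=> hm hA; rewrite rev_cons -cats1 catA => cy.
set B := A ++ _ in cy *.
have cy2 := one_cycle_conj hm cy.
have cx : coxeter p (B ++ [:: m.+1; m.+1]) B.
  by have := @coxeter_inv p B [::] m.+1 hm; rewrite !cats0.
have e : B ++ [:: m.+1; m.+1] = (B ++ [:: m.+1]) ++ [:: m.+1] by rewrite -catA.
have okB : in_range p B.
  rewrite /in_range /B all_cat all_rev all_map; apply/andP; split => //.
  by apply: sub_all hA => k; lia.
have ht : trivial_closure p (B ++ [:: m.+1; m.+1]).
  apply/(coxeter_trivial cx); first by rewrite (coxeter_in_range cx).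
    by rewrite e.
  apply: IH => //; apply: eq_one_cycle cy2 => x.
  by rewrite -e (coxeter_act cx).
move=> [|[m' l] z] //= [-> ez] hun; rewrite flat_code_conj ?ez //.
apply: ht; first by rewrite unzip1_cat ez -catA.
by rewrite unzip2_cat cats1 rcons_uniq.
Qed.

(** Number the strands by pass: [f] at the entrance of the word, [g] at its exit. A strand leaving
    at y.+1 enters at y as the next pass, so away from position 0 [g] is [f] lowered by one and
    moved by one position. The two sorting words then agree up to a shift of letters, which gives
    the palindromic form. *)
Lemma descending_trivial p w : 0 < p -> in_range p w -> one_cycle p w -> trivial_closure p w.
Proof.
case: p => // p _ hw cy; have [hX hp] := cy.
set X := pass_starts _ _ in hX; set T := turn _ _ in hp.
pose f k := index k X; pose g := f \o act (rev w).
have sX : size X = p.+1 by rewrite (perm_size hX) size_iota.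
have uX : uniq X by rewrite (perm_uniq hX) iota_uniq.
have nX i : i < p.+1 -> nth p X i = iter i T p by move=> hi; rewrite nth_traject.
have memX k : (k \in X) = (k < p.+1) by rewrite (perm_mem hX) mem_iota.
have flt k : k < p.+1 -> f k < p.+1 by move=> hk; rewrite /f -[X in _ < X]sX index_mem memX.
have fK k : k < p.+1 -> iter (f k) T p = k.
  by move=> hk; rewrite -nX ?flt // nth_index // memX.
have Kf i : i < p.+1 -> f (iter i T p) = i.
  by move=> hi; rewrite -nX // /f index_uniq // sX.
have fI : {in gtn p.+1 &, injective f}.
  by move=> i j hi hj e; rewrite -(fK i) // -(fK j) // e.
have gE y : y < p.+1 -> exists i, [/\ g y = i, i < p.+1 & iter i.+1 T p = return_pos p.+1 y].
  move=> hy; exists (g y); have hr : in_range p.+1 (rev w) by rewrite /in_range all_rev.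
  have := act_lt hr hy; split; rewrite ?flt //=.
  by rewrite fK // /T /turn act_revK.
(* Position 0 leads back to the start of the walk, so the strand leaving there is the last pass.
   There are now [p.+1] strands, with passes numbered from 0 to [p]. *)
have g0 : g 0 = p.
  have [i [-> hi e]] := gE 0 isT; apply/eqP; rewrite eqn_leq -ltnS hi leqNgt.
  apply/negP => lt; have := Kf i.+1 lt; rewrite e /= => h.
  by have := Kf 0 isT; rewrite /= h.
have gS y : y < p -> g y.+1 = (f y).-1.
  move=> hy; have [i [-> hi e]] := gE y.+1 hy.
  have [lt|ge] := ltnP i.+1 p.+1; first by rewrite -[y in RHS]/(return_pos p.+1 y.+1) -e Kf.
  have ei : i = p by lia.
  by move: e; rewrite ei hp /=; lia.
have f0 : f p = 0 by apply: (Kf 0).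
have fpos k : k < p -> 0 < f k.
  move=> hk; rewrite lt0n; apply/eqP => e0.
  by have := fK k (ltnW hk); rewrite e0 /=; lia.
(* Pass 0 enters at the bottom and the last pass leaves at the top, so each is already in place for
   decreasing order. *)
have eA : sorting_word p.+1 f = sorting_word p f by apply: sorting_word_min => k _; rewrite f0.
have eg : sorting_word p.+1 g = map S (sorting_word p f).
  rewrite /= (_ : count _ _ = 0).
    rewrite cats0; congr map; apply: sorting_word_mono => i j hi hj; rewrite !gS //.
    by have := fpos i hi; have := fpos j hj; lia.
  apply/eqP; rewrite -leqn0 leqNgt -has_count; apply/hasP => -[k].
  rewrite mem_iota g0 => /andP[_ hk]; rewrite gS //.
  by have := flt k (ltnW hk); lia.
have := coxeter_normal hw fI; rewrite -/g eA eg => cx.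
apply/(coxeter_trivial cx) => //; apply: trivial_palindrome.
  by apply: sub_all (in_range_sorting_word p f).
by apply: eq_one_cycle cy => x; rewrite (coxeter_act cx).
Qed.

(** * The virtual torus knots *)

Definition pos_letter (t : nat * bool) : letter := (t.1, t.2, true).

Lemma braid_pass_cat w1 w2 k x :
  braid_pass (w1 ++ w2) k x =
  ((braid_pass w1 k x).1 ++ (braid_pass w2 (k + size w1) (braid_pass w1 k x).2).1,
   (braid_pass w2 (k + size w1) (braid_pass w1 k x).2).2).
Proof.
elim: w1 k x => [|g w1 IH] k x; first by rewrite addn0 /=; case: (braid_pass w2 k x).
rewrite [(_ :: _) ++ _]/= [braid_pass (g :: (_ ++ _)) _ _]/= [braid_pass (g :: w1) _ _]/=.
case: (gen_step g k x) => o y; rewrite IH addSnnS.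
case: (braid_pass w1 k.+1 y) => s1 y1 /=.
by case: o.
Qed.

Lemma braid_pass_Vir w k x :
  braid_pass (map Vir (map S w)) k x.+1 = ([::], (act w x).+1).
Proof.
elim: w k x => //= m w IH k x; rewrite !eqSS /swap.
by case: eqP => _; [|case: eqP => _]; rewrite IH.
Qed.

Lemma braid_pass_Sig w k x :
  braid_pass (map Sig (map S w)) k x.+1 =
  (map pos_letter (flat_pass (zip w (iota k (size w))) x), (act w x).+1).
Proof.
elim: w k x => //= m w IH k x; rewrite !eqSS /swap.
by case: eqP => _; [|case: eqP => _]; rewrite IH.
Qed.

Lemma act_iota a n x :
  act (iota a n) x = if x == a then a + n else if a < x <= a + n then x.-1 else x.
Proof.
elim: n a x => [|n IH] a x /=.
  by case h : (x == a); [move/eqP: h => ->; rewrite addn0 | case: ifP; lia].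
rewrite IH /swap; case h1 : (x == a); first by rewrite /= eqxx; lia.
case h2 : (x == a.+1); last by rewrite h2; do ! case: ifP; lia.
by move/eqP: h2 => ->; do ! case: ifP; lia.
Qed.

Lemma act_return_pos p x : x < p -> act (iota 0 p.-1) x = return_pos p x.
Proof. by rewrite act_iota /return_pos; case: x => [|x] //= h; case: ifP; lia. Qed.

Lemma return_pos_lt p x : x < p -> return_pos p x < p.
Proof. by case: x => [|x] /=; lia. Qed.

Definition torus_word (p n : nat) : seq nat := flatten (nseq n (iota 0 p.-1)).

(* The first p-1 labels belong to the virtual block. *)
Definition torus_lword (p n : nat) : seq (nat * nat) :=
  zip (torus_word p n) (iota p.-1 (size (torus_word p n))).

Lemma unzip1_torus p n : unzip1 (torus_lword p n) = torus_word p n.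
Proof. by rewrite unzip1_zip // size_iota. Qed.

Lemma unzip2_torus p n : unzip2 (torus_lword p n) = iota p.-1 (size (torus_word p n)).
Proof. by rewrite unzip2_zip // size_iota. Qed.

Lemma size_torus_word p n : size (torus_word p n) = p.-1 * n.
Proof. by rewrite /torus_word; elim: n => [|n IH] /=; rewrite ?muln0 // size_cat size_iota IH mulnS. Qed.

Lemma in_range_torus p n : in_range p (torus_word p n).
Proof.
rewrite /torus_word; elim: n => //= n IH; rewrite /in_range all_cat; apply/andP; split => //.
by apply/allP => m; rewrite mem_iota; lia.
Qed.

(** The virtual block leaves no letters and moves positions as the return arcs do. In particular it
    carries the base point from the top to position [p.-1], where the flat walk starts. *)
Lemma VT1_flat_code p q : 0 < p -> VT1 p q = map pos_letter (flat_code p (torus_lword p q.-1)).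
Proof.
move=> hp; rewrite /VT1 /braid_closure /flat_code /pass_starts.
have -> : flatten (nseq q.-1 (torus_block p)) = map Sig (map S (torus_word p q.-1)).
  rewrite /torus_word; elim: q.-1 => //= n ->.
  by rewrite !map_cat iota_succ.
rewrite -(iota_succ 0) unzip1_torus.
set w := torus_word p q.-1.
have key n x : x < p -> closure_iter n
    ([seq Vir i | i <- [seq i.+1 | i <- iota 0 p.-1]] ++ [seq Sig i | i <- [seq i.+1 | i <- w]]) x.+1 =
  [seq pos_letter i | i <- flatten [seq flat_pass (torus_lword p q.-1) x | x <- traject (turn p w) (return_pos p x) n]].
  elim: n x => //= n IH x hx.
  rewrite braid_pass_cat braid_pass_Vir /= act_return_pos // braid_pass_Sig /= map_cat !size_map size_iota.
  rewrite IH //; apply: act_lt; [exact: in_range_torus | exact: return_pos_lt].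
exact: key.
Qed.

(** Each of the q - 1 blocks, and the return as well, rotates positions by -1 modulo p, written as
    adding [p.-1]. *)
Lemma turn_torus p q x : 0 < q -> x < p ->
  turn p (torus_word p q.-1) x = (x + q * p.-1) %% p.
Proof.
move=> hq hx; rewrite /turn.
have rE y : y < p -> return_pos p y = (y + p.-1) %% p.
  case: y => [|y] hy /=; first by rewrite modn_small //; lia.
  by rewrite (_ : y.+1 + p.-1 = y + p) ?modnDr ?modn_small //; lia.
have hp : 0 < p by lia.
have aE n : act (torus_word p n) x = (x + n * p.-1) %% p.
  rewrite /torus_word; elim: n => [|n IH]; first by rewrite addn0 modn_small.
  rewrite -addn1 nseqD flatten_cat act_cat IH /= cats0 act_return_pos ?ltn_mod // rE ?ltn_mod //.
  by rewrite modnDml -addnA; congr ((_ + _) %% _); lia.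
rewrite aE rE ?ltn_mod // modnDml -addnA -[X in _ + X]mulSnr prednK //.
Qed.

Lemma one_cycle_torus p q : 0 < p -> 0 < q -> coprime p q -> one_cycle p (torus_word p q.-1).
Proof.
move=> hp hq cop; set c := q * p.-1.
have it i : iter i (turn p (torus_word p q.-1)) p.-1 = (p.-1 + i * c) %% p.
  elim: i => [|i IH]; first by rewrite addn0 modn_small //=; lia.
  rewrite /= IH turn_torus ?ltn_mod // modnDml -addnA; congr ((_ + _) %% _).
  by rewrite mulSnr.
split; last first.
  by rewrite it addnC mulnC modnMDl modn_small; lia.
have -> : pass_starts p (torus_word p q.-1) = [seq (p.-1 + i * c) %% p | i <- iota 0 p].
  rewrite -[pass_starts _ _](mkseq_nth 0) /pass_starts size_traject.
  apply/eq_in_map => i; rewrite mem_iota => /andP[_ hi].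
  by rewrite (set_nth_default p.-1) ?size_traject // nth_traject // it.
have change : coprime p c.
  by rewrite coprimeMr cop coprimenP.
have us : uniq [seq (p.-1 + i * c) %% p | i <- iota 0 p].
  rewrite map_inj_in_uniq ?iota_uniq // => i j; rewrite !mem_iota /= => hi hj.
  wlog ij : i j hi hj / i <= j.
    by move=> hw h; case/orP: (leq_total i j) => l; [apply: hw|symmetry; apply: hw].
  move/eqP; rewrite eqn_modDl eq_sym eqn_mod_dvd ?leq_mul2r ?ij ?orbT // -mulnBl Gauss_dvdl //.
  by move=> /dvdnP [[|k]]; rewrite ?mulSn; lia.
apply: uniq_perm; rewrite ?iota_uniq //.
have [||//] := uniq_min_size us (s2 := iota 0 p); last by rewrite size_map.
by move=> y /mapP [i _ ->]; rewrite mem_iota /= ltn_mod.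
Qed.

(** * Indices and signs of the crossings *)

Definition label_pairs (ls : seq nat) : flat_gcode := flatten [seq [:: (l, true); (l, false)] | l <- ls].

Lemma perm_flatten_cat (T : eqType) (A B : nat -> seq T) X :
  perm_eq (flatten [seq A x ++ B x | x <- X]) (flatten (map A X) ++ flatten (map B X)).
Proof.
elim: X => //= x X IH; apply/permP => P; have /permP/(_ P) := IH.
by rewrite !count_cat; lia.
Qed.

Lemma perm_flat_pass_label_pairs p z X : in_range p (unzip1 z) -> perm_eq X (iota 0 p) ->
  perm_eq (flatten [seq flat_pass z x | x <- X]) (label_pairs (unzip2 z)).
Proof.
elim: z X => [|[m l] z IH] X /=.
  by move=> _ _; have -> : flatten [seq flat_pass [::] x | x <- X] = [::] by elim: X.
case/andP=> hm hz hX.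
rewrite (eq_map (g := fun x => flat_pass [:: (m, l)] x ++ flat_pass z (swap m x))); last first.
  by move=> x; exact: (flat_pass_cat [:: (m, l)]).
apply: perm_trans (perm_flatten_cat _ _ _) _.
rewrite -[X in perm_eq _ X]/([:: (l, true); (l, false)] ++ label_pairs (unzip2 z)).
apply: perm_cat; last first.
  rewrite (map_comp (flat_pass z)); apply: IH => //.
  apply: perm_trans (perm_map (swap m) hX) (perm_map_swap hm).
have := @perm_act_filter p [::] X [:: m; m.+1] isT hX.
rewrite map_id /= !inE => /(_ _ _)/perm_eq2 h.
have e : flatten [seq flat_pass [:: (m, l)] x | x <- X] =
    flatten [seq flat_pass [:: (m, l)] x | x <- X & x \in [:: m; m.+1]].
  elim: (X) => //= x Y ->; rewrite !inE; case h1 : (x == m); first by rewrite /= h1.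
  by case h2 : (x == m.+1); rewrite /= ?h1 ?h2.
rewrite e; case: h => [||->|->] /=; rewrite ?eqxx ?(gtn_eqF (ltnSn m)) //.
- by lia.
- by move=> k; rewrite !inE; lia.
- by apply/permP => P /=; lia.
Qed.

Lemma total_label_pairs ls : total (map pos_letter (label_pairs ls)) = 0%R.
Proof.
elim: ls => [|l ls IH]; first by rewrite /total big_nil.
by rewrite /label_pairs /= /total !big_cons -/(total _) IH.
Qed.

Lemma labels_pos_letter F : labels (map pos_letter F) = flat_labels F.
Proof. by rewrite /labels -map_comp; apply: eq_map. Qed.

Lemma mem_label_pairs ls l : (l \in flat_labels (label_pairs ls)) = (l \in ls).
Proof. by elim: ls => //= k ls IH; rewrite !inE IH orbA orbb. Qed.

Lemma paired_label_pairs ls : uniq ls -> paired (map pos_letter (label_pairs ls)).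
Proof.
elim: ls => [|l ls IH] /=; first by move=> _ c; left.
case/andP=> hl /IH h.
apply/(@paired_cat [:: (l, true, true); (l, false, true)]); last by split; [apply: paired2|].
by move=> c; rewrite labels_pos_letter mem_label_pairs /= !inE orbb => /eqP ->.
Qed.

(** Nonzero index at every crossing. As crossing changes preserve heights, the property survives
    them. *)
Definition separated (x : gcode) : Prop := forall u v, u \in heights 0 x -> v \in heights 0 x ->
  lab u.1 = lab v.1 -> is_over u.1 != is_over v.1 -> u.2 != v.2.

Lemma separated_change c x : separated x -> separated (crossing_change c x).
Proof.
move=> hx u v; rewrite heights_change => /mapP [u' hu ->] /mapP [v' hv ->] /=.
rewrite !lab_change => e; rewrite /change_letter e => ho.
apply: (hx u' v') => //; move: ho; case: ifP => _ //=.
by rewrite /is_over /=; case: (u'.1.1.2); case: (v'.1.1.2).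
Qed.

(** For a paired code this is the writhe, each crossing being counted through its over letter. *)
Definition over_sum (x : gcode) : int := (\sum_(t <- x | is_over t) sign_int (is_pos t))%R.

Lemma over_sum_perm x y : perm_eq x y -> over_sum x = over_sum y.
Proof. exact: perm_big. Qed.

Lemma index_writhe_separated x : paired x -> separated x -> index_writhe x = over_sum x.
Proof.
move=> hp hs; rewrite /index_writhe /pair_sum.
have -> : over_sum x = (\sum_(u <- heights 0 x | is_over u.1) sign_int (is_pos u.1))%R.
  by rewrite /over_sum -[in LHS](map_fst_heights 0 x) big_map.
rewrite [RHS]big_mkcond big_seq [RHS]big_seq; apply: eq_bigr => u hu.
case: ifP => ho; last first.
  by rewrite big1 // => v _; rewrite /pair_weight ho andbF.
have e : (\sum_(v <- heights 0 x) pair_weight u v =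
    \sum_(v <- heights 0 x | (lab v.1 == lab u.1) && ~~ is_over v.1) sign_int (is_pos u.1))%R.
  rewrite [RHS]big_mkcond big_seq [RHS]big_seq; apply: eq_bigr => v hv.
  rewrite /pair_weight ho eq_sym; case: eqP => //= el; case ov : (is_over v.1) => //=.
  by rewrite (hs u v) // ho ov.
rewrite e big_const_seq.
have -> : count (fun v => (lab v.1 == lab u.1) && ~~ is_over v.1) (heights 0 x) =
    count (fun t => ~~ is_over t) (filter (fun t => lab t == lab u.1) x).
  rewrite count_filter -[in RHS](map_fst_heights 0 x) count_map.
  by apply: eq_count => v /=; rewrite andbC.
have hu' : u.1 \in filter (fun t => lab t == lab u.1) x.
  by rewrite mem_filter eqxx -[X in _ \in X](map_fst_heights 0 x) map_f.
case: (hp (lab u.1)) => [|[s]] h.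
  by move: hu'; rewrite (perm_mem h).
by rewrite (permP h) /= addr0.
Qed.

Lemma eps_pos_letter t : eps (pos_letter t) = if t.2 then 1%R else (-1)%R.
Proof. by rewrite /eps /upward; case: t => c []. Qed.

Lemma total_flat_pass z x : total (map pos_letter (flat_pass z x)) = ((act (unzip1 z) x)%:Z - x%:Z)%R.
Proof.
elim: z x => [|[m l] z IH] x /=; first by rewrite /total big_nil; lia.
rewrite /swap; case: eqP => [->|_]; last case: eqP => [->|_]; last exact: IH.
  by rewrite /total /= big_cons -/(total _) IH eps_pos_letter /=; lia.
by rewrite /total /= big_cons -/(total _) IH eps_pos_letter /=; lia.
Qed.

(** On positive letters the height moves together with the position, and both ways through a
    crossing at m have m.+1 as the larger end. *)
Lemma heights_flat_pass z x (o : int) u :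
  u \in heights (x%:Z + o)%R (map pos_letter (flat_pass z x)) ->
  exists2 m, (m, lab u.1) \in z & u.2 = (m%:Z + 1 + o)%R.
Proof.
elim: z x => //= -[m l] z IH x.
have wk y : u \in heights (y%:Z + o)%R (map pos_letter (flat_pass z y)) ->
    exists2 m0, (m0, lab u.1) \in (m, l) :: z & u.2 = (m0%:Z + 1 + o)%R.
  by move=> /IH [m0 h1 h2]; exists m0; rewrite // inE h1 orbT.
case: eqP => [->|_]; last case: eqP => [->|_]; last exact: wk.
  rewrite /= eps_pos_letter inE => /orP[/eqP ->|].
    by exists m; rewrite ?mem_head //= /upward /=; lia.
  by move=> h; apply: (wk m.+1); rewrite (_ : (m.+1%:Z + o = m%:Z + o + 1)%R) //; lia.
rewrite /= eps_pos_letter inE => /orP[/eqP ->|].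
  by exists m; rewrite ?mem_head //= /upward /=; lia.
by move=> h; apply: (wk m); rewrite (_ : (m%:Z + o = m.+1%:Z + o - 1)%R) //; lia.
Qed.

(** A return arc lowers the position by one but leaves the height alone, so the offset between them
    grows by one with each pass. The hypothesis on iterates excludes the return from position 0 to
    the bottom. *)
Lemma heights_passes p z x n (o : int) u :
  (forall j, j.+1 < n -> iter j.+1 (turn p (unzip1 z)) x != p.-1) ->
  u \in heights (x%:Z + o)%R
    (map pos_letter (flatten [seq flat_pass z y | y <- traject (turn p (unzip1 z)) x n])) ->
  exists i m, [/\ u.1 \in map pos_letter (flat_pass z (iter i (turn p (unzip1 z)) x)),
    (m, lab u.1) \in z & u.2 = (m%:Z + 1 + o + i%:Z)%R].
Proof.
elim: n x o => //= n IH x o hT.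
rewrite map_cat heights_cat mem_cat => /orP[h|].
  have [m h1 h2] := heights_flat_pass h; exists 0, m; split=> //; last by rewrite h2 addr0.
  by rewrite /= -(map_fst_heights (x%:Z + o)%R (map _ _)); apply: map_f.
set T := turn _ _ in hT IH *; rewrite total_flat_pass.
case: n IH hT => // n IH hT.
have hx : act (unzip1 z) x = (T x).+1.
  by have := hT 0 isT; rewrite /= /T /turn /return_pos; case: (act _ _) => //; rewrite eqxx.
have -> : (x%:Z + o + ((act (unzip1 z) x)%:Z - x%:Z) = (T x)%:Z + (o + 1))%R.
  by rewrite hx; lia.
move=> /IH []; first by move=> j hj; rewrite -iterSr; apply: hT.
move=> i [m [h1 h2 h3]]; exists i.+1, m; split=> //; first by rewrite iterSr.
by rewrite h3; lia.
Qed.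

Lemma uniq_flat_labels_flat_pass z x : uniq (unzip2 z) -> uniq (flat_labels (flat_pass z x)).
Proof.
elim: z x => //= -[m l] z IH x /= /andP[hl hz].
have nl y : l \notin flat_labels (flat_pass z y) by apply: contra hl => /flat_labels_flat_pass.
by case: ifP => _; [|case: ifP => _]; rewrite /= ?nl IH.
Qed.

Lemma uniq_map_inj (A B : eqType) (f : A -> B) s : uniq (map f s) ->
  {in s &, injective f}.
Proof.
elim: s => //= x s IH /andP[hx /IH h] y t; rewrite !inE.
case/orP => [/eqP ->|hy] /orP[/eqP ->|ht] //; last exact: h.
  by move=> e; rewrite e map_f in hx.
by move=> e; rewrite -e map_f in hx.
Qed.

(** Both passages of a crossing occur at the same m, so equal heights would force equal pass
    numbers; but one pass never meets a crossing twice. *)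
Lemma separated_flat_code p z : 0 < p -> one_cycle p (unzip1 z) -> uniq (unzip2 z) ->
  separated (map pos_letter (flat_code p z)).
Proof.
move=> hp [hX _] hz u v hu hv el ho; apply/eqP => ev.
set T := turn p (unzip1 z).
have key w : w \in heights 0 (map pos_letter (flat_code p z)) ->
  exists i m, [/\ w.1 \in map pos_letter (flat_pass z (iter i T p.-1)),
    (m, lab w.1) \in z & w.2 = (m%:Z + 1 + - p.-1%:Z + i%:Z)%R].
  (* The walk starts at position [p.-1] with height 0, so the initial offset is minus [p.-1]. *)
  rewrite -[0%R](addrN (p.-1)%:Z%R); apply: heights_passes => j hj.
  have uX : uniq (pass_starts p (unzip1 z)) by rewrite (perm_uniq hX) iota_uniq.
  have := nth_uniq p.-1 (i := j.+1) (j := 0) _ _ uX.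
  by rewrite /pass_starts size_traject !nth_traject // => -> //.
have [i [m [h1 h2 h3]]] := key u hu.
have [j [n [g1 g2 g3]]] := key v hv.
have emn : m = n.
  have /(_ (m, lab u.1) (n, lab v.1) h2 g2 el) [] // := @uniq_map_inj _ _ snd z hz.
have eij : i = j by move: h3; rewrite ev g3 emn; lia.
move: h1 g1; rewrite eij => /mapP [s hs es] /mapP [t ht et].
have /(_ s t hs ht) h := uniq_map_inj (uniq_flat_labels_flat_pass (iter j T p.-1) hz).
by move: ho; rewrite es et h ?eqxx //; move: el; rewrite es et.
Qed.

(** * Changing crossings into the descending diagram *)

Definition change_all (D : seq nat) (x : gcode) : gcode := foldl (fun y c => crossing_change c y) x D.

Definition flip (D : seq nat) (t : letter) : letter :=
  if lab t \in D then (lab t, ~~ is_over t, ~~ is_pos t) else t.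

Lemma change_all_flip D x : uniq D -> change_all D x = map (flip D) x.
Proof.
rewrite /change_all; elim: D x => [|c D IH] x /=.
  by move=> _; rewrite map_id.
case/andP=> hc /IH ->; rewrite -map_comp; apply: eq_map => t /=.
rewrite -/(change_letter c t) /flip lab_change /change_letter inE.
by case: eqP => // ->; rewrite (negbTE hc).
Qed.

Lemma change_all_ind (P : gcode -> Prop) D x :
  (forall c y, P y -> P (crossing_change c y)) -> P x -> P (change_all D x).
Proof. by move=> h; rewrite /change_all; elim: D x => //= c D IH x hx; apply/IH/h. Qed.

Lemma unknots_change_all D x : {subset D <= labels x} ->
  vequiv (change_all D x) unknot -> unknots_with (size D) x.
Proof.
elim: D x => [|c D IH] x //= hD hv; exists x, c; split.
- exact: rst_refl.
- by apply: hD; rewrite mem_head.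
- apply: IH => // d hd; rewrite labels_change; apply: hD; by rewrite inE hd orbT.
Qed.

Definition passages (F : flat_gcode) (c : nat) : flat_gcode := [seq t <- F | t.1 == c].

(** The two passages of a crossing have opposite directions, so comparison with the head of
    [passages] tells the first from the second and the scan becomes a letterwise map. *)
Lemma mark_passages S F :
  {in flat_labels F, forall c, c \notin S ->
     exists d, passages F c = [:: (c, d); (c, ~~ d)]} ->
  mark S F = [seq (t.1, (t.1 \notin S) && (ohead (passages F t.1) == Some t),
                   ((t.1 \notin S) && (ohead (passages F t.1) == Some t)) == t.2) | t <- F].
Proof.
elim: F S => //= -[c d] F IH S h; rewrite eqxx /= eqxx andbT; congr (_ :: _).
rewrite IH.
  apply/eq_in_map => -[c' d'] ht /=; rewrite inE negb_or /passages /=.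
  rewrite [c' == c]eq_sym; case: (c =P c') => //= e; subst c'.
  have [//|hc] := boolP (c \in S).
  have [d0] := h c (mem_head _ _) hc; rewrite /passages /= eqxx => -[<- hF].
  have : (c, d') \in [seq t <- F | t.1 == c] by rewrite mem_filter eqxx.
  rewrite hF inE => /eqP [->].
  by have -> : (Some (c, d) == Some (c, ~~ d)) = false by apply/eqP => -[]; case: (d).
move=> c' hc'; rewrite inE negb_or => /andP[cc' hS].
have [|d0 e] := h c' _ hS; first by rewrite inE hc' orbT.
by exists d0; move: e; rewrite /passages /= eq_sym (negbTE cc').
Qed.

Lemma passages_label_pairs ls c : uniq ls -> c \in ls ->
  passages (label_pairs ls) c = [:: (c, true); (c, false)].
Proof.
have h0 s : c \notin s -> passages (label_pairs s) c = [::].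
  elim: s => //= k s IH; rewrite inE negb_or => /andP[ck /IH].
  by rewrite /passages /= eq_sym (negbTE ck).
elim: ls => //= k ls IH /andP[hk us]; rewrite inE => /orP[/eqP e|hc].
  by subst k; rewrite /passages /= eqxx -/(passages _ _) h0.
rewrite /passages /=; case: eqP => [e|_]; last exact: IH.
by rewrite e hc in hk.
Qed.

(** At a positive crossing the passage from m to m.+1 is over, so the descending marking disagrees
    exactly where the passage from m.+1 to m comes first. *)
Lemma mark_flip F ls : uniq ls -> perm_eq F (label_pairs ls) ->
  mark [::] F =
  map (flip [seq l <- ls | passages F l == [:: (l, false); (l, true)]]) (map pos_letter F).
Proof.
move=> us hF; set D := filter _ _.
have hp c : c \in ls -> passages F c = [:: (c, true); (c, false)] \/
                        passages F c = [:: (c, false); (c, true)].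
  move=> hc; apply: perm_eq2; rewrite -(passages_label_pairs us hc); exact: perm_filter.
have hl c : c \in flat_labels F -> c \in ls by rewrite (perm_mem (perm_map fst hF)) mem_label_pairs.
rewrite mark_passages; last first.
  by move=> c /hl /hp [->|->] _; [exists true | exists false].
rewrite -map_comp; apply/eq_in_map => -[l d] ht /=.
have ll : l \in ls by apply: hl; apply: (map_f fst ht).
rewrite /flip /pos_letter /lab /is_over /is_pos /= mem_filter ll andbT.
have eS b b' : (Some (l, b) == Some (l, b')) = (b == b').
  by apply/eqP/eqP => [[]|->].
have eL : ([:: (l, true); (l, false)] == [:: (l, false); (l, true)]) = false.
  by apply/eqP => -[].
by case: (hp l ll) => ->; rewrite [ohead _]/= !eS ?eL ?eqxx; case: (d).
Qed.

Lemma over_sum_flip_label_pairs D ls :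
  over_sum (map (flip D) (map pos_letter (label_pairs ls))) =
  ((size ls)%:Z - 2 * (count (mem D) ls)%:Z)%R.
Proof.
rewrite /over_sum; elim: ls => [|l ls IH]; first by rewrite big_nil.
rewrite /= !big_cons -/(label_pairs ls) IH /flip /lab /is_over /is_pos /=.
by case: (l \in D) => /=; lia.
Qed.

Theorem theorem1p1 (p q : nat) :
  0 < p -> 0 < q -> coprime p q ->
  virtually_null_homotopic (VT1 p q) /\
  is_virtual_unknotting_number (VT1 p q) ((p.-1 * q.-1) %/ 2).
Proof.
move=> hp hq cop; set w := torus_word p q.-1; set z := torus_lword p q.-1.
have ez : unzip1 z = w by apply: unzip1_torus.
have cy : one_cycle p w by apply: one_cycle_torus.
have uz : uniq (unzip2 z) by rewrite unzip2_torus iota_uniq.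
have sz : size (unzip2 z) = p.-1 * q.-1 by rewrite unzip2_torus size_iota size_torus_word.
set F := flat_code p z; set ls := unzip2 z in uz sz.
have hF : perm_eq F (label_pairs ls).
  apply: perm_flat_pass_label_pairs; rewrite ez; [exact: in_range_torus | by case: cy].
set x := VT1 p q; have ex : x = map pos_letter F by apply: VT1_flat_code.
have px : paired x.
  rewrite ex; apply: paired_perm (paired_label_pairs uz).
  by rewrite perm_sym; apply: perm_map.
have sx : separated x by rewrite ex; apply: separated_flat_code; rewrite ?ez.
have tx : total x = 0%R by rewrite ex (total_perm (perm_map pos_letter hF)) total_label_pairs.
(* The crossings of the torus diagram whose first passage is under. *)
set D := [seq l <- ls | passages F l == [:: (l, false); (l, true)]].
have uD : uniq D by apply: filter_uniq.
have osumE E : over_sum (map (flip E) x) = ((p.-1 * q.-1)%:Z - 2 * (count (mem E) ls)%:Z)%R.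
  by rewrite ex (over_sum_perm (perm_map _ (perm_map pos_letter hF))) over_sum_flip_label_pairs sz.
have hx : index_writhe x = (p.-1 * q.-1)%:Z%R.
  rewrite index_writhe_separated // -[x in LHS]map_id (osumE [::]).
  by rewrite (eq_count (a2 := pred0)) // count_pred0; lia.
have hD : vequiv (change_all D x) unknot.
  rewrite change_all_flip // ex -mark_flip //.
  by apply: descending_trivial (in_range_torus p q.-1) cy _ _ _.
(* The changed diagram still has all indices nonzero, so its index writhe is its full writhe, the
   number of crossings minus twice [size D]. Being that of an unknot, it vanishes. *)
have szD : size D * 2 = p.-1 * q.-1.
  have [_ h _] := inv_vequiv hD.
  have td : total (change_all D x) = 0%R by apply: (@change_all_ind (fun y => total y = 0%R) D x _ tx) => c y; rewrite total_change.
  have pd : paired (change_all D x) by apply: (@change_all_ind paired D x _ px); apply: paired_change.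
  have sd : separated (change_all D x) by apply: (@change_all_ind separated D x _ sx); apply: separated_change.
  move: (h td); rewrite index_writhe_separated // change_all_flip // osumE /index_writhe /pair_sum big_nil.
  have -> : count (mem D) ls = size D.
    rewrite /D size_filter; apply: eq_in_count => l hl /=.
    by rewrite mem_filter hl andbT.
  lia.
have hk : (p.-1 * q.-1) %/ 2 = size D by rewrite -szD mulnK.
have hu : unknots_with (size D) x.
  apply: unknots_change_all => // l; rewrite mem_filter => /andP[_ hl].
  by rewrite ex labels_pos_letter (perm_mem (perm_map fst hF)) mem_label_pairs.
split; first by exists (size D).
(* The index writhe starts at twice [size D], and each crossing change lowers it by at most 2. *)
rewrite hk; split=> // m /unknots_with_index_writhe /(_ px tx).
by rewrite hx -szD; lia.
Qed.
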